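(* Let $v_h$ and $w_h$ be two functions in $\mathbb{V}_h$ with $v_h\le w_h$ in $\Omega$ and equality attained at some interior node $x_i\in\mathcal{N}_h$. Then the integral operator satisfies $$I_\epsilon v_h(x_i)\le I_\epsilon w_h(x_i).$$ In addition, if the mesh $\mathcal{T}_h$ is weakly acute, then the discrete Laplacian satisfies $$\Delta_hv_h(x_i)\le\Delta_hw_h(x_i),$$ whence $L_h^\epsilon v_h(x_i)\le L_h^\epsilon w_h(x_i)$.
   Context: $d\ge2$; $\Omega\subset\mathbb{R}^d$ is a bounded domain partitioned exactly by a conforming mesh $\mathcal{T}_h$ of simplices. $A:\Omega\to\mathbb{R}^{d\times d}$ is measurable with symmetric values and $\lambda I\le A(x)\le\Lambda I$ for a.e. $x$, $0<\lambda\le\Lambda$. $Q:=(\Lambda-\lambda/2)^{1/2}$, $\epsilon>0$. $\varphi\ge0$ is a fixed smooth radially symmetric function on $\mathbb{R}^d$ with compact support in the unit ball and $\int|y|^2\varphi(y)\,dy=d$. $\mathcal{N}_h$: interior nodes; $\mathbb{V}_h$: continuous functions on $\overline\Omega$ affine on each $K\in\mathcal{T}_h$; $\phi_i$: hat function of node $x_i$; $\omega_i=\operatorname{supp}\phi_i$. Weak acuteness: $k_{ij}:=\int_\Omega\nabla\phi_i\cdot\nabla\phi_j\le0$ for all nodes $x_i\ne x_j$ of $\mathcal{T}_h$ (boundary nodes included). Second differences: for $x$ with $\operatorname{dist}(x,\partial\Omega)>Q\epsilon$ put $\theta(x)=1$; for $x\in\Omega$ with $\operatorname{dist}(x,\partial\Omega)\le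 Q\epsilon$ let $\theta(x)\in(0,1]$ be the largest number such that $x\pm\theta y\in\Omega$ for all $y\in B_{Q\epsilon}(0)$. Set $\delta v(x,y):=\theta^{-2}[v(x+\theta y)+v(x-\theta y)-2v(x)]$, $\theta=\theta(x)$. Operators: $\bar A(x_i)=A(x_i)$ if $A$ is continuous, otherwise $\bar A(x_i)=|\omega_i|^{-1}\int_{\omega_i}A$; $M(x_i)=(\bar A(x_i)-\frac\lambda2I)^{1/2}$; $I_\epsilon v(x_i)=\int_{\mathbb{R}^d}\frac{\delta v(x_i,y)}{\epsilon^{d+2}\det M(x_i)}\varphi\big(\frac{M(x_i)^{-1}y}{\epsilon}\big)dy$; $\Delta_hv_h(x_i)=-(\int_\Omega\phi_i)^{-1}\int_\Omega\nabla v_h\cdot\nabla\phi_i$; $L_h^\epsilon v_h(x_i)=\frac\lambda2\Delta_hv_h(x_i)+I_\epsilon v_h(x_i)$ for $x_i\in\mathcal{N}_h$. *)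

(* Defs.v *)
From HB Require Import structures.
From mathcomp Require Import all_boot all_order all_algebra.
From mathcomp Require Import all_classical all_reals all_analysis.

Set Implicit Arguments.
Unset Strict Implicit.
Unset Printing Implicit Defensive.

Import Order.TTheory GRing.Theory Num.Theory.
Import numFieldNormedType.Exports.

Local Open Scope classical_set_scope.
Local Open Scope ring_scope.

(* Points of R^d are row vectors.  The library topology of 'rV[R]_d is the
   usual one, but the library norm is the sup norm: Euclidean lengths are
   given by enorm. *)
Section euclidean.
Context {R : realType} {d : nat}.
Implicit Types (x y : 'rV[R]_d) (X : set 'rV[R]_d).

Definition dot x y : R := \sum_(j < d) x 0 j * y 0 j.

Definition enorm x : R := Num.sqrt (dot x x).

Definition topboundary X : set 'rV[R]_d := closure X `\` interior X.

Definition edist x X : R := inf [set enorm (x - z) | z in X].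

(* The product B y, for y seen as a column. *)
Definition mxapply (B : 'M[R]_d) y : 'rV[R]_d := (B *m y^T)^T.

Definition loewner_le (B C : 'M[R]_d) : Prop :=
  forall x, 0 <= dot x (mxapply (C - B) x).

(* The symmetric positive semidefinite square root; 0 if there is none. *)
Definition sqrtmx (B : 'M[R]_d) : 'M[R]_d :=
  xget 0 [set M : 'M[R]_d | [/\ M^T = M, loewner_le 0 M & M *m M = B]].

End euclidean.

(* Lebesgue measure on R^d is the restriction of the outer measure
   lebesgue_outer to its Caratheodory measurable sets, that is, to the
   Lebesgue measurable sets (so it is complete).  The empty box None is
   only needed in dimension 0, where every other box has volume 1. *)
Section lebesgue_outer.
Context {R : realType} {d : nat}.
Implicit Types (e : option ('rV[R]_d * 'rV[R]_d)) (X : set 'rV[R]_d).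

Definition box e : set 'rV[R]_d :=
  if e is Some (a, b) then [set x | forall j, a 0 j < x 0 j <= b 0 j]
  else set0.

Definition box_vol e : R :=
  if e is Some (a, b) then \prod_(j < d) Num.max 0 (b 0 j - a 0 j) else 0.

Local Open Scope ereal_scope.

Definition lebesgue_outer X : \bar R :=
  ereal_inf [set \sum_(k <oo) (box_vol (F k))%:E |
             F in [set F | X `<=` \bigcup_k box (F k)]].

Lemma box_vol_ge0 e : 0 <= (box_vol e)%:E.
Proof.
by case: e => [[a b]|] //=; rewrite lee_fin prodr_ge0// => j _; rewrite le_max lexx.
Qed.

Lemma lebesgue_outer_ge0 X : 0 <= lebesgue_outer X.
Proof.
apply: le_ereal_inf_tmp => _ [F _ <-].
by apply: nneseries_ge0 => n _ _; exact: box_vol_ge0.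
Qed.

Lemma lebesgue_outer0 : lebesgue_outer set0 = 0.
Proof.
apply/eqP; rewrite eq_le lebesgue_outer_ge0 andbT.
apply: ereal_inf_lbound; exists (fun=> None); first by move=> x [].
by rewrite eseries0.
Qed.

Lemma le_lebesgue_outer : {homo lebesgue_outer : X Y / X `<=` Y >-> X <= Y}.
Proof.
move=> X Y XY; apply/ereal_inf_le_tmp => _ [F YF <-].
by exists F => //; exact: subset_trans XY YF.
Qed.

Lemma lebesgue_outer_sigma_subadditive : sigma_subadditive lebesgue_outer.
Proof.
move=> A; have [[i ioo]|] := pselect (exists i, lebesgue_outer (A i) = +oo).
  rewrite (eseries_pinfty _ _ ioo) ?leey// => n _.
  by rewrite -ltNye (lt_le_trans _ (lebesgue_outer_ge0 _)).
rewrite -forallNE => Aoo.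
suff add2e (e : {posnum R}) : lebesgue_outer (\bigcup_n A n) <=
    \sum_(i <oo) lebesgue_outer (A i) + e%:num%:E.
  by apply/lee_addgt0Pr => _/posnumP[].
rewrite (le_trans _ (epsilon_trick _ _ _))//; last first.
  by move=> n; exact: lebesgue_outer_ge0.
pose P n (F : nat -> option ('rV[R]_d * 'rV[R]_d)) :=
  A n `<=` \bigcup_k box (F k) /\
  \sum_(k <oo) (box_vol (F k))%:E <=
    lebesgue_outer (A n) + (e%:num / (2 ^ n.+1)%:R)%:E.
have [G PG] : {G & forall n, P n (G n)}.
  apply: (@choice _ _ P) => n.
  have en1 : (0 < e%:num / (2 ^ n.+1)%:R :> R)%R by [].
  have Afin : lebesgue_outer (A n) \is a fin_num.
    by rewrite ge0_fin_numE ?lebesgue_outer_ge0// ltey; apply/eqP/Aoo.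
  have [_ [F AF <-] /ltW AFe] := lb_ereal_inf_adherent en1 Afin.
  by exists F.
have vG_ge0 x : 0 <= (box_vol (uncurry G x))%:E by exact: box_vol_ge0.
apply: (@le_trans _ _ (\esum_(i in setT) (box_vol (uncurry G i))%:E)).
  apply: ereal_inf_lbound => /=.
  have /card_esym/ppcard_eqP[f] := card_nat2.
  exists (uncurry G \o f).
    move=> t [i _ /(PG i).1[j _ Gij]].
    by exists (f^-1%FUN (i, j)) => //=; rewrite invK ?inE.
  rewrite -(esum_pred_image (fun x => (box_vol (uncurry G x))%:E) _ xpredT)
    ?[fun=> _]set_true//.
  by rewrite image_eq.
rewrite (_ : esum _ _ = \sum_(i <oo) \sum_(j <oo) (box_vol (G i j))%:E); last first.
  pose J : nat -> set (nat * nat) := fun i => [set (i, j) | j in setT].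
  rewrite (_ : setT = \bigcup_k J k); last first.
    by rewrite predeqE => -[a b]; split => // _; exists a => //; exists b.
  rewrite esum_bigcupT /=; last 2 first.
    - apply/trivIsetP => i j _ _ ij.
      rewrite predeqE => -[n m] /=; split => //= -[] [_] _ [<-{n} _].
      by move=> [m' _] [] /esym/eqP; rewrite (negbTE ij).
    - by move=> [n m]; exact: vG_ge0.
  rewrite -(image_id [set: nat]) -fun_true esum_pred_image//; last first.
    by move=> n _; exact: esum_ge0.
  apply: eq_eseriesr => /= j _.
  rewrite -(esum_pred_image (fun x => (box_vol (uncurry G x))%:E) (pair j) predT)//=.
  - by congr esum; rewrite predeqE => -[a b]; split; move=> [i _ <-]; exists i.
  - by move=> n _; exact: (vG_ge0 (j, n)).
  - by move=> ? ? _ _; exact: (@can_inj _ _ _ snd).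
apply: lee_nneseries => i; last by move=> _; exact: (PG i).2.
by move=> _ _; apply: nneseries_ge0 => m _ _; exact: (vG_ge0 (i, m)).
Qed.

HB.instance Definition _ := isOuterMeasure.Build R 'rV[R]_d lebesgue_outer
  lebesgue_outer0 lebesgue_outer_ge0 le_lebesgue_outer
  lebesgue_outer_sigma_subadditive.

End lebesgue_outer.

Definition lebesgue_outer_measure (R : realType) (d : nat) :
  {outer_measure set 'rV[R]_d -> \bar R} := lebesgue_outer.

(* The points of 'rV[R]_d with the Lebesgue sigma-algebra. *)
Notation lebesgueRd R d := (caratheodory_type (lebesgue_outer_measure R d)).

Definition lebesgueM {R : realType} {d : nat} : set (lebesgueRd R d) -> \bar R :=
  lebesgue_outer_measure R d.

HB.instance Definition _ (R : realType) (d : nat) :=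
  Measure.on (@lebesgueM R d).

Section calculus.
Context {R : realType} {d : nat}.
Implicit Types (f : 'rV[R]_d -> R) (x : 'rV[R]_d).

Definition partial (j : 'I_d) f : 'rV[R]_d -> R := fun x => 'D_('e_j) f x.

Definition grad f x : 'rV[R]_d := \row_j partial j f x.

Definition smooth f : Prop := forall s : seq 'I_d,
  continuous (foldr partial f s) /\
  forall j x, derivable (foldr partial f s) x 'e_j.

Definition integral_kernel (phi : 'rV[R]_d -> R) : Prop :=
  [/\ smooth phi,
      forall y, 0 <= phi y,
      forall y z, enorm y = enorm z -> phi y = phi z,
      closure [set y | phi y != 0] `<=` [set y | enorm y <= 1] &
      \int[lebesgueM]_y (enorm y ^+ 2 * phi y) = d%:R].

End calculus.

(* A simplicial mesh: its nodes, indexed by an ordinal type, and its cells,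
   each given by the set of (indices of) its vertices. *)
Record mesh (R : realType) (d : nat) := Mesh {
  nnode : nat ;
  node : 'I_nnode -> 'rV[R]_d ;
  cells : {set {set 'I_nnode}} }.

Arguments nnode {R d}.
Arguments node {R d}.
Arguments cells {R d}.

Section mesh_theory.
Context {R : realType} {d : nat}.
Variables (Omega : set 'rV[R]_d) (T : mesh R d).
Implicit Types (i j : 'I_(nnode T)) (K : {set 'I_(nnode T)}).

Definition simplex K : set 'rV[R]_d :=
  [set x | exists c : 'I_(nnode T) -> R,
    [/\ forall i, 0 <= c i, \sum_(i in K) c i = 1 &
        x = \sum_(i in K) c i *: node T i]].

Definition affinely_independent K : Prop :=
  forall c : 'I_(nnode T) -> R,
    \sum_(i in K) c i = 0 -> \sum_(i in K) c i *: node T i = 0 ->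
    {in K, forall i, c i = 0}.

(* T is a conforming mesh of nondegenerate simplices that partitions Omega:
   two cells meet exactly along the hull of their common vertices, possibly
   empty; this makes the interiors of distinct cells disjoint. *)
Definition conforming_mesh : Prop :=
  [/\ injective (node T),
      forall i, exists2 K, K \in cells T & i \in K,
      forall K, K \in cells T -> #|K| = d.+1 /\ affinely_independent K,
      forall K K', K \in cells T -> K' \in cells T ->
        simplex K `&` simplex K' = simplex (K :&: K')%SET &
      closure Omega = \bigcup_(K in [set` cells T]) simplex K /\
      forall K, K \in cells T -> interior (simplex K) `<=` Omega].

(* The space V_h.  Functions on the closure of Omega are represented by
   functions on R^d, whose values elsewhere are irrelevant. *)
Definition fe_space (v : 'rV[R]_d -> R) : Prop :=
  {within closure Omega, continuous v} /\
  forall K, K \in cells T ->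
    exists (g : 'rV[R]_d) (c : R), forall x, simplex K x -> v x = dot g x + c.

Definition hat i : 'rV[R]_d -> R :=
  get [set f | fe_space f /\ forall j, f (node T j) = (j == i)%:R].

Definition hat_supp i : set 'rV[R]_d :=
  closure [set x | closure Omega x /\ hat i x != 0].

Definition stiffness i j : R :=
  \int[lebesgueM]_(x in Omega) dot (grad (hat i) x) (grad (hat j) x).

Definition weakly_acute : Prop := forall i j, i != j -> stiffness i j <= 0.

Definition discrete_laplacian (v : 'rV[R]_d -> R) i : R :=
  - (\int[lebesgueM]_(x in Omega) hat i x)^-1 *
    \int[lebesgueM]_(x in Omega) dot (grad v x) (grad (hat i) x).

End mesh_theory.

Section operators.
Context {R : realType} {d : nat}.
Variables (Omega : set 'rV[R]_d) (T : mesh R d).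
Variables (A : 'rV[R]_d -> 'M[R]_d) (lambda Lambda eps : R).
Variable phi : 'rV[R]_d -> R.
Implicit Types (x y : 'rV[R]_d) (v : 'rV[R]_d -> R) (i : 'I_(nnode T)).

Definition elliptic_coefficient : Prop :=
  [/\ forall k l, measurable_fun (Omega : set (lebesgueRd R d))
                    (fun x : lebesgueRd R d => A x k l),
      forall x, Omega x -> (A x)^T = A x &
      {ae @lebesgueM R d, forall x, Omega x ->
        loewner_le lambda%:M (A x) /\ loewner_le (A x) Lambda%:M}].

Definition Qconst : R := Num.sqrt (Lambda - lambda / 2).

Definition admissible_scale x : set R :=
  [set t | 0 < t <= 1 /\
    forall y, enorm y < Qconst * eps -> Omega (x + t *: y) /\ Omega (x - t *: y)].

(* Near the boundary, the largest admissible scale. *)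
Definition theta x : R :=
  if Qconst * eps < edist x (topboundary Omega) then 1
  else xget 0 (admissible_scale x `&` ubound (admissible_scale x)).

Definition second_diff v x y : R :=
  (theta x ^+ 2)^-1 * (v (x + theta x *: y) + v (x - theta x *: y) - 2 * v x).

Definition Abar i : 'M[R]_d :=
  if `[< {within Omega, continuous A} >] then A (node T i)
  else \matrix_(k, l) ((fine (lebesgueM (hat_supp Omega i)))^-1 *
         \int[lebesgueM]_(x in hat_supp Omega i) A x k l).

Definition Mroot i : 'M[R]_d := sqrtmx (Abar i - (lambda / 2)%:M).

Definition integral_op v i : R :=
  \int[lebesgueM]_y
    (second_diff v (node T i) y / (eps ^+ (d + 2) * \det (Mroot i)) *
     phi (eps^-1 *: mxapply (invmx (Mroot i)) y)).

Definition discrete_op v i : R :=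
  lambda / 2 * discrete_laplacian Omega v i + integral_op v i.

End operators.

(* Main.v *)
(* Let [u = w - v], which is nonnegative and vanishes at [x_i].  For the
   integral operator the integrands compare pointwise: where the kernel does
   not vanish, [|y| < Q eps], because [M] has norm at most [Q]; so the points
   [x_i +- theta y] lie in Omega, and the difference of the integrands is a
   nonnegative multiple of [u(x_i + theta y) + u(x_i - theta y)].  For the
   Laplacian, [u] expands in the hat functions, so that
   [\int grad u . grad phi_i = sum_j u(x_j) k_ji], where the term [j = i]
   vanishes and the others are nonpositive by weak acuteness. *)

Require Import Defs.
From mathcomp Require Import all_boot all_order all_algebra.
From mathcomp Require Import all_classical all_reals all_analysis.
From mathcomp Require Import ring lra.

Set Implicit Arguments.
Unset Strict Implicit.
Unset Printing Implicit Defensive.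

Import Order.TTheory GRing.Theory Num.Theory.
Import numFieldNormedType.Exports.

Local Open Scope classical_set_scope.
Local Open Scope ring_scope.

(** * Lebesgue measure on R^d *)

(** Monotonicity of the integral requires both integrands to be integrable, and much of the work
    goes there. Gradients are pointwise directional derivatives, controlled only in the interiors of
    cells, so the faces must be null sets: this is why [lebesgueM], built from covers by boxes, is
    developed as far as the nullity of hyperplanes. Since [hat] is a choice by [get], nothing is
    known of it before a function with its properties is built; barycentric coordinates are glued
    across cells for this purpose, which is where conformity enters. The constant [Q] appears
    because [M] squares to [Abar - lambda / 2], which is at most [Lambda - lambda / 2]. Ellipticity
    holds only almost everywhere, however: for continuous [A] the bound reaches the node because
    nonempty open sets are not null, and otherwise it is integrated over the support of the hat
    function. Finally, the nodal expansion of [u] involves boundary nodes, where the sign of [u]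
    comes from continuity up to the boundary. *)

Section lebesgue.
Context {R : realType} {d : nat}.
Implicit Types (x y g : 'rV[R]_d) (X U : set 'rV[R]_d).
Implicit Types (e : option ('rV[R]_d * 'rV[R]_d)).

Local Notation measurableRd := (@measurable _ (lebesgueRd R d)).

Definition box_le (j : 'I_d) (t : R) e :=
  if e is Some (a, b)
  then Some (a, \row_k (if k == j then Num.min (b 0 k) t else b 0 k)) else None.

Definition box_gt (j : 'I_d) (t : R) e :=
  if e is Some (a, b)
  then Some (\row_k (if k == j then Num.max (a 0 k) t else a 0 k), b) else None.

(** One of the two pieces may be empty, its side in direction [j] being negative; the [Num.max 0] in
    [box_vol] then counts it as 0. *)
Lemma box_vol_cut j t e :
  box_vol (box_le j t e) + box_vol (box_gt j t e) = box_vol e.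
Proof.
case: e => [[a b]|] /=; last by rewrite addr0.
rewrite !(bigD1 (P := xpredT) j)//= !mxE eqxx.
under eq_bigr => k /negPf kj do rewrite mxE kj.
under [in X in _ + X]eq_bigr => k /negPf kj do rewrite mxE kj.
rewrite -mulrDl; congr (_ * _).
rewrite /Num.max /Num.min; do ![case: ifPn]; rewrite -?leNgt => *; lra.
Qed.

Lemma box_le_sub j t e : box e `&` [set x | x 0 j <= t] `<=` box (box_le j t e).
Proof.
case: e => [[a b]|] x []//= xab xt k; have /andP[-> xb] := xab k.
by rewrite mxE; case: eqVneq => // ->; rewrite le_min xt andbT; case/andP: (xab j).
Qed.

Lemma box_gt_sub j t e : box e `&` ~` [set x | x 0 j <= t] `<=` box (box_gt j t e).
Proof.
case: e => [[a b]|] x []//= xab /negP; rewrite -ltNge => xt k.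
have /andP[ax ->] := xab k; rewrite andbT.
by rewrite mxE; case: eqVneq => // ->; rewrite gt_max xt andbT; case/andP: (xab j).
Qed.

(** Caratheodory's criterion: cutting every box of a cover of [X] along the hyperplane yields covers
    of the two pieces of [X], with the same total volume. *)
Lemma measurable_halfspace (j : 'I_d) (t : R) :
  measurableRd [set x | x 0 j <= t].
Proof.
apply: le_caratheodory_measurable => X.
apply: le_ereal_inf_tmp => _ [F XF <-].
rewrite -(eq_eseriesr (fun k _ => congr1 EFin (box_vol_cut j t (F k)))).
under eq_eseriesr do rewrite EFinD.
rewrite nneseriesD; [|by move=> *; exact: box_vol_ge0..].
apply: leeD; apply: ereal_inf_lbound.
- exists (box_le j t \o F) => //= x [/XF[k _ Fkx] xt].
  by exists k => //; apply: box_le_sub.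
- exists (box_gt j t \o F) => //= x [/XF[k _ Fkx] xt].
  by exists k => //; apply: box_gt_sub.
Qed.

Lemma measurable_box e : measurableRd (box e).
Proof.
case: e => [[a b]|]; last exact: measurable0.
rewrite (_ : box _ = \bigcap_(j in [set: 'I_d])
   ([set x | x 0 j <= b 0 j] `\` [set x | x 0 j <= a 0 j])).
  apply: fin_bigcap_measurable => [|j _]; first exact: finite_finset.
  by apply: measurableD; exact: measurable_halfspace.
apply/seteqP; split=> x /= xab j.
  by move=> _; have /andP[ax xb] := xab j; split => //=; apply/negP; rewrite -ltNge.
by have [//|/= -> /negP] := xab j; rewrite -ltNge => ->.
Qed.

Lemma ball_coord x y r : 0 < r -> ball x r y <-> forall j, `|x 0 j - y 0 j| < r.
Proof.
move=> r0; split=> [[_ xy] j|xy]; first exact: xy.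
by split => // i j; rewrite ord1; exact: xy.
Qed.

(** The boxes with rational corners contained in [U] are countably many and exhaust it. *)
Lemma open_measurable_Rd U : open U -> measurableRd U.
Proof.
move=> oU.
pose B (p : 'rV[rat]_d * 'rV[rat]_d) : set 'rV[R]_d :=
  box (Some (map_mx ratr p.1, map_mx ratr p.2)).
pose F p : set 'rV[R]_d := [set x | B p x /\ B p `<=` U].
rewrite (_ : U = \bigcup_p F p).
  apply: countable_bigcupT_measurable; first exact: countableP.
  move=> p; have [BU|BU] := pselect (B p `<=` U).
    rewrite (_ : F p = B p); first exact: measurable_box.
    by apply/seteqP; split => x; [case|].
  rewrite (_ : F p = set0); first exact: measurable0.
  by apply/seteqP; split => x; [case|].
apply/seteqP; split => [x Ux|x [p _ []]]; last by move=> Bx; exact.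
have /nbhs_ballP[e /= e0 eU] := open_nbhs_nbhs (conj oU Ux).
have /choice[a aP] (j : 'I_d) : exists q : rat, x 0 j - e / 2 < ratr q < x 0 j.
  have [|q] := @rat_in_itvoo R (x 0 j - e / 2) (x 0 j); first lra.
  by rewrite in_itv/=; exists q.
have /choice[b bP] (j : 'I_d) : exists q : rat, x 0 j < ratr q < x 0 j + e / 2.
  have [|q] := @rat_in_itvoo R (x 0 j) (x 0 j + e / 2); first lra.
  by rewrite in_itv/=; exists q.
exists (\row_j a j, \row_j b j) => //; split.
  by move=> j; rewrite !mxE; have := aP j; have := bP j; lra.
move=> y By; apply: eU; apply/ball_coord => // j.
have := By j; rewrite !mxE; have := aP j; have := bP j.
by rewrite ltr_norml; lra.
Qed.

Lemma closed_measurable_Rd X : closed X -> measurableRd X.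
Proof.
by move=> cX; rewrite -(setCK X); apply: measurableC; apply: open_measurable_Rd;
  exact: closed_openC.
Qed.

Lemma ler_coord_norm x j : `|x 0 j| <= `|x|.
Proof. by rewrite [leRHS]/Num.Def.normr/= mx_normrE;
  apply/bigmax_geP; right => /=; exists (0, j). Qed.

Lemma lebesgue_bounded_fin X : bounded_set X -> (lebesgueM (X : set (lebesgueRd R d)) < +oo)%E.
Proof.
move=> [M [_ /(_ (M + 1))]] /(_ ltac:(lra)) bX.
pose b : 'rV[R]_d := const_mx (M + 1).
(* Boxes are open on the left, so [a] must lie strictly below [- (M + 1)]. *)
pose a : 'rV[R]_d := const_mx (- (M + 2)).
pose F n : option ('rV[R]_d * 'rV[R]_d) := if n is 0%N then Some (a, b) else None.
have XF : (lebesgue_outer X <= \sum_(k <oo) (box_vol (F k))%:E)%E.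
  apply: ereal_inf_lbound; exists F => // x Xx; exists 0%N => //= j.
  rewrite !mxE; have /= := bX _ Xx; have := ler_coord_norm x j.
  by rewrite ler_norml; lra.
apply: (le_lt_trans XF).
rewrite (nneseries_split 0 1)/=; last by move=> *; exact: box_vol_ge0.
rewrite eseries0 ?adde0; last by case.
by rewrite big_mkord big_ord1 ltry.
Qed.

Lemma lebesgue_outer_le_translate c X :
  (lebesgue_outer [set x | X (x + c)%R] <= lebesgue_outer X)%E.
Proof.
apply: le_ereal_inf_tmp => _ [F XF <-].
pose sh e : option ('rV[R]_d * 'rV[R]_d) :=
  if e is Some (a, b) then Some (a - c, b - c) else None.
apply: ereal_inf_lbound; exists (sh \o F).
  move=> x /XF[k _ Fkx]; exists k => //=; move: Fkx; case: (F k) => [[a b]|]//= H j.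
  by have := H j; rewrite !mxE; lra.
apply: eq_eseriesr => k _ /=; congr EFin; case: (F k) => [[a b]|]//=.
by apply: eq_bigr => j _; rewrite !mxE; congr (Num.max _ _); lra.
Qed.

Lemma lebesgue_translate c X :
  lebesgueM ([set x | X (x + c)] : set (lebesgueRd R d)) =
  lebesgueM (X : set (lebesgueRd R d)).
Proof.
apply/eqP; rewrite eq_le lebesgue_outer_le_translate/=.
rewrite {1}(_ : X = [set x | [set y | X (y + c)] (x - c)]).
  exact: lebesgue_outer_le_translate.
by apply/seteqP; split => x/=; rewrite subrK.
Qed.


Lemma lebesgue_null_measurable X : lebesgueM (X : set (lebesgueRd R d)) = 0%E -> measurableRd X.
Proof.
move=> X0; apply: le_caratheodory_measurable => Y.
have -> : lebesgue_outer_measure R d (Y `&` X) = 0%E.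
  by apply/eqP; rewrite eq_le outer_measure_ge0 andbT -X0 le_outer_measure.
by rewrite add0e le_outer_measure.
Qed.

Lemma lebesgue_null_sub X U : X `<=` U -> lebesgueM (U : set (lebesgueRd R d)) = 0%E ->
  lebesgueM (X : set (lebesgueRd R d)) = 0%E.
Proof.
move=> XU U0; apply/eqP; rewrite eq_le lebesgue_outer_ge0 andbT -U0.
exact: le_lebesgue_outer.
Qed.

Lemma lebesgue_null_bigcup (I : countType) (F : I -> set 'rV[R]_d) :
  (forall i, lebesgueM (F i : set (lebesgueRd R d)) = 0%E) ->
  lebesgueM (\bigcup_i F i : set (lebesgueRd R d)) = 0%E.
Proof.
move=> F0; pose G n := if unpickle n is Some i then F i else set0.
apply/eqP; rewrite eq_le lebesgue_outer_ge0 andbT.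
have -> : \bigcup_i F i = \bigcup_n G n.
  apply/seteqP; split=> x [i _ Fx]; first by exists (pickle i); rewrite // /G pickleK.
  by move: Fx; rewrite /G; case: unpickle => // j Fx; exists j.
apply: (le_trans (lebesgue_outer_sigma_subadditive _)).
rewrite eseries0// => n _ _; rewrite /G; case: unpickle => [i|]; first exact: F0.
exact: lebesgue_outer0.
Qed.

(* Countably many translates of a nonempty open set cover the space.  The
   nontriviality of the measure is a hypothesis because the normalization of
   the kernel provides it, which spares the computation of the volume of a box. *)
Lemma open_lebesgue_neq0 U : lebesgueM (setT : set (lebesgueRd R d)) <> 0%E ->
  open U -> U !=set0 -> lebesgueM (U : set (lebesgueRd R d)) <> 0%E.
Proof.
move=> T0 oU [x Ux] U0; apply: T0.
have /nbhs_ballP[e /= e0 eU] := open_nbhs_nbhs (conj oU Ux).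
pose c (k : 'rV[int]_d) : 'rV[R]_d := (e / 2) *: map_mx (fun n : int => n%:~R) k.
apply: (@lebesgue_null_sub _ (\bigcup_k [set y | U (y + c k)])).
  (* Subtracting the integer part of the displacement, in units of [e / 2], leaves each coordinate
     within [e / 2] of that of [x]. *)
  move=> y _; exists (\row_j - Num.floor ((y 0 j - x 0 j) / (e / 2))) => //=.
  apply: eU; apply/ball_coord => // j; rewrite !mxE.
  set t := ((_ - _) / _); have := Num.Theory.floor_itv t.
  rewrite rmorphN/= intrD => /andP[/= t1 t2].
  have : y 0 j - x 0 j = t * (e / 2) by rewrite /t divfK// gt_eqF//; lra.
  rewrite ltr_norml => yx; apply/andP; split; nra.
by apply: lebesgue_null_bigcup => k; rewrite lebesgue_translate.
Qed.

Lemma dot_continuous g : continuous (dot g : 'rV[R]_d -> R).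
Proof.
apply: continuous_big => [|j _ x]; first exact: add_continuous.
by apply: (@continuousM _ _ (fun=> g 0 j) (fun y => y 0 j));
  [exact: cst_continuous|exact: coord_continuous].
Qed.

Lemma dotDr g x y : dot g (x + y) = dot g x + dot g y.
Proof. by rewrite -big_split/=; apply: eq_bigr => j _; rewrite mxE mulrDr. Qed.

Lemma dotZr g k x : dot g (k *: x) = k * dot g x.
Proof. by rewrite mulr_sumr; apply: eq_bigr => j _; rewrite mxE mulrCA. Qed.

Lemma dot_delta g j : dot g (delta_mx 0 j) = g 0 j.
Proof.
have -> : dot g (delta_mx 0 j) = \sum_k g 0 k * (k == j)%:R.
  by apply: eq_bigr => k _; rewrite mxE eqxx.
rewrite (bigD1 j)//= eqxx mulr1 big1 ?addr0// => k /negPf ->.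
by rewrite mulr0.
Qed.

(* The translates of a bounded piece of the hyperplane by [e_j / (n + 1)] are
   disjoint, of equal measure, and lie in one bounded set. *)
Lemma bounded_hyperplane_null g c r : g != 0 ->
  lebesgueM ([set x | dot g x = c /\ `|x| <= r] : set (lebesgueRd R d)) = 0%E.
Proof.
move=> g0; set H := [set x | _].
have [j gj] : exists j, g 0 j != 0.
  by apply/existsP; apply: contraNT g0 => /existsPn g0; apply/eqP/rowP => j; rewrite mxE;
    apply/eqP/negPn/g0.
pose t (n : nat) : 'rV[R]_d := n.+1%:R^-1 *: delta_mx 0 j.
pose E n : set (lebesgueRd R d) := [set x | H (x + t n)].
have tn n : `|t n| <= 1.
  rewrite [leLHS]/Num.Def.normr/= mx_normrE; apply/bigmax_leP; split => //= -[i k] _ /=.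
  rewrite !mxE normrM ger0_norm ?invr_ge0// mulr_ile1// ?invr_le1 ?unitfE ?ler1n ?invr_ge0//.
  by case: (_ && _); rewrite ?normr1 ?normr0.
have cH : closed H.
  apply: closedI.
    apply: (@closed_comp _ _ (dot g) [set c]); last exact: closed_eq.
    by move=> x _; exact: dot_continuous.
  apply: (@closed_comp _ _ (fun x : 'rV[R]_d => `|x|) [set y | y <= r]); last exact: closed_le.
  by move=> x _; exact: norm_continuous.
have mE n : measurable (E n).
  apply: closed_measurable_Rd; apply: (@closed_comp _ _ (fun x => x + t n) H) => // x _.
  by apply: (@continuousD _ _ _ id (fun=> t n)); [exact: cvg_id|exact: cst_continuous].
(* Along [e_j] the form [dot g] has slope [g 0 j != 0], so a point common to two translates forces
   equal shifts. *)
have tE : trivIset setT E.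
  apply/trivIsetP => m n _ _ mn; apply/seteqP; split => // x [[+ _] [+ _]].
  rewrite !dotDr !dotZr dot_delta => <- /addrI/(mulIf gj)/invr_inj/eqP.
  by rewrite eqr_nat eqSS eq_sym (negPf mn).
have := measure_bigcup (@lebesgueM R d) setT E (fun n _ => mE n) tE.
set C := lebesgueM (\bigcup_n E n) => CE.
have C_fin : (C < +oo)%E.
  apply: lebesgue_bounded_fin; exists (r + 1); split => [|M rM x [n _ [_ xr]]]/=;
    first exact: num_real.
  apply: le_trans (ltW rM); rewrite -(addrK (t n) x) (le_trans (ler_normB _ _))//.
  by rewrite lerD.
have {}CE : C = \big[+%E/0%E]_(0 <= i <oo) lebesgueM (H : set (lebesgueRd R d)).
  apply: (etrans CE); apply: congr_lim; apply/funext => n; apply: eq_big => [k|k _];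
    first by rewrite /= in_setT.
  by rewrite -(lebesgue_translate (t k) H).
set m := lebesgueM _ in CE *.
have m0 : (0 <= m)%E by exact: lebesgue_outer_ge0.
apply/eqP; rewrite eq_le m0 andbT leNgt; apply/negP => mgt0.
have mC n : (m *+ n <= C)%E.
  rewrite CE; apply: le_trans (nneseries_lim_ge n _); last by [].
  by rewrite big_mkord sumr_const card_ord.
have mfin : m \is a fin_num by rewrite ge0_fin_numE// (le_lt_trans (mC 1%N)).
have Cfin : C \is a fin_num by rewrite ge0_fin_numE// lebesgue_outer_ge0.
move: mC mgt0; rewrite -(fineK mfin) -(fineK Cfin) lte_fin => mC mgt0.
(* Archimedes: this multiple of a positive [m] exceeds the finite measure [C] of the union of the
   translates. *)
have := mC (Num.truncn (fine C / fine m)).+1; rewrite -EFin_natmul lee_fin leNgt -mulr_natl.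
rewrite -ltr_pdivrMr//; apply/negP/negPn.
by have /truncn_itv/andP[] : 0 <= fine C / fine m
  by rewrite divr_ge0 ?fine_ge0 ?lebesgue_outer_ge0.
Qed.

Lemma hyperplane_null g c : g != 0 ->
  lebesgueM ([set x | dot g x = c] : set (lebesgueRd R d)) = 0%E.
Proof.
move=> g0; apply: (@lebesgue_null_sub _ (\bigcup_n [set x | dot g x = c /\ `|x| <= n%:R])).
  move=> x gx; exists (Num.trunc `|x|).+1 => //; split => //.
  by have /truncn_itv/andP[_ /ltW] := normr_ge0 x.
by apply: lebesgue_null_bigcup => n; exact: bounded_hyperplane_null.
Qed.

Lemma continuous_open_measurable_fun (D : set 'rV[R]_d) (f : 'rV[R]_d -> R) :
  open D -> {in D, continuous f} -> measurable_fun (D : set (lebesgueRd R d)) f.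
Proof.
move=> oD cf; apply: (measurability _ (measurable_realfun.RGenOpens.measurableE R)).
move=> _ [_ [a [b ->] <-]]; apply: open_measurable_Rd.
rewrite openE => x [Dx fx]; apply: filterI; first exact: open_nbhs_nbhs.
by apply: cf; [rewrite inE|apply: open_nbhs_nbhs; split => //; exact: interval_open].
Qed.

(** By completeness, whatever [f] does on the null set [E \ D] is measurable; gradients take
    uncontrolled values on the faces. *)
Lemma null_measurable_fun (D E : set 'rV[R]_d) (f : 'rV[R]_d -> R) :
  measurableRd D -> D `<=` E -> lebesgueM (E `\` D : set (lebesgueRd R d)) = 0%E ->
  measurable_fun (D : set (lebesgueRd R d)) f -> measurable_fun (E : set (lebesgueRd R d)) f.
Proof.
move=> mD DE ED0 mf.
rewrite -(setDUK DE); apply/measurable_funU => //; first exact: lebesgue_null_measurable.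
split => // _ Y mY; apply: lebesgue_null_measurable.
by apply: lebesgue_null_sub ED0 => x [].
Qed.

(** The common integrability criterion for gradients, coefficients and the integrand of the integral
    operator. *)
Lemma ae_bounded_integrable (D E : set 'rV[R]_d) (f : 'rV[R]_d -> R) (M : R) :
  bounded_set E -> measurableRd D -> D `<=` E ->
  lebesgueM (E `\` D : set (lebesgueRd R d)) = 0%E ->
  measurable_fun (D : set (lebesgueRd R d)) f -> (forall x, D x -> `|f x| <= M) ->
  (@lebesgueM R d).-integrable E (EFin \o f).
Proof.
move=> bE mD DE ED0 mf fM.
have mN := lebesgue_null_measurable ED0.
have mE : measurableRd E by rewrite -(setDUK DE); exact: measurableU.
apply/(negligible_integrable mN mE _ ED0).
  by apply/measurable_realfun.measurable_EFinP; exact: null_measurable_fun mf.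
rewrite setDD setIidr//; apply: measurable_bounded_integrable => //.
  by apply: le_lt_trans (lebesgue_bounded_fin bE); exact: le_lebesgue_outer.
exists M; split => [|N MN x Dx]/=; first exact: num_real.
by apply: le_trans (ltW MN); exact: fM.
Qed.

Lemma Rintegral_null (D E : set 'rV[R]_d) (f : 'rV[R]_d -> R) :
  measurableRd D -> D `<=` E -> lebesgueM (E `\` D : set (lebesgueRd R d)) = 0%E ->
  (@lebesgueM R d).-integrable E (EFin \o f) ->
  \int[lebesgueM]_(x in E) f x = \int[lebesgueM]_(x in D) f x.
Proof.
move=> mD DE ED0 If; have mN := lebesgue_null_measurable ED0.
have mE : measurableRd E by rewrite -(setDUK DE); exact: measurableU.
rewrite /Rintegral (negligible_integral mN mE If ED0).
by rewrite setDD setIidr.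
Qed.

End lebesgue.

(** Both claims share one induction, because additivity of the integral uses the integrability of
    the remaining sum. *)
Lemma integrable_Rintegral_sum (disp : measure_display) (X : measurableType disp) (R : realType)
    (mu : {measure set X -> \bar R}) (D : set X) (I : Type) (s : seq I) (f : I -> X -> R) :
  measurable D -> (forall k, mu.-integrable D (EFin \o f k)) ->
  mu.-integrable D (EFin \o (fun x => \sum_(k <- s) f k x)) /\
  \int[mu]_(x in D) (\sum_(k <- s) f k x) = \sum_(k <- s) \int[mu]_(x in D) f k x.
Proof.
move=> mD If; elim: s => [|k s [IHi IHe]].
  split; last by rewrite big_nil; under eq_Rintegral do rewrite big_nil; rewrite Rintegral_cst// mul0r.
  rewrite (_ : _ \o _ = cst 0%E); first exact: integrable0.
  by apply/funext => x /=; rewrite big_nil.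
have sE : (fun x => \sum_(k <- k :: s) f k x) = (fun x => f k x + \sum_(k <- s) f k x).
  by apply/funext => x; rewrite big_cons.
rewrite sE big_cons -IHe; split; last exact: RintegralD.
exact: (integrableD mD (If k) IHi).
Qed.

(** Serves the nodes on the boundary of the domain. A strict reverse inequality at [x] would persist
    nearby within the closure, hence at a point of [O]. *)
Lemma within_le_closure (R : realType) (d : nat) (O : set 'rV[R]_d) (v w : 'rV[R]_d -> R) :
  {within closure O, continuous v} -> {within closure O, continuous w} ->
  (forall x, O x -> v x <= w x) -> forall x, closure O x -> v x <= w x.
Proof.
move=> /subspace_continuousP cv /subspace_continuousP cw vw x Ox.
rewrite leNgt; apply/negP => wv.
have cvw : v y - w y @[y --> within (closure O) (nbhs x)] --> v x - w x.
  by apply: cvgB; [exact: cv|exact: cw].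
have near_wv : \forall y \near within (closure O) (nbhs x), 0 < v y - w y.
  by apply: (cvgr_gt (v x - w x)); rewrite ?subr_gt0.
have [y [Oy /(_ (subset_closure Oy))]] := Ox _ near_wv.
by rewrite subr_gt0 ltNge vw.
Qed.

(** * Quadratic forms and barycentric coordinates *)

Section linear_algebra.
Context {R : realType} {d : nat}.
Implicit Types (x y z g : 'rV[R]_d) (B M : 'M[R]_d).

Lemma dotE x y : dot x y = (x *m y^T) 0 0.
Proof. by rewrite mxE; apply: eq_bigr => j _; rewrite mxE. Qed.

Lemma dotC x y : dot x y = dot y x.
Proof. by apply: eq_bigr => j _; rewrite mulrC. Qed.

Lemma dotxx_ge0 x : 0 <= dot x x.
Proof. by apply: sumr_ge0 => j _; rewrite -expr2 sqr_ge0. Qed.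

Lemma dotxx_eq0 x : dot x x = 0 -> x = 0.
Proof.
move=> /psumr_eq0P x0; apply/rowP => j; rewrite mxE.
by apply/eqP; rewrite -sqrf_eq0 expr2 x0// => k _; rewrite -expr2 sqr_ge0.
Qed.

Lemma mxapplyE B y : mxapply B y = y *m B^T.
Proof. by rewrite /mxapply trmx_mul trmxK. Qed.

Lemma mxapplyD B C y : mxapply (B + C) y = mxapply B y + mxapply C y.
Proof. by rewrite !mxapplyE linearD/= mulmxDr. Qed.

Lemma mxapply_scalar t y : mxapply t%:M y = t *: y.
Proof. by rewrite mxapplyE tr_scalar_mx mul_mx_scalar. Qed.

Lemma mxapplyZ t B y : mxapply (t *: B) y = t *: mxapply B y.
Proof. by rewrite !mxapplyE linearZ/= -scalemxAr. Qed.

(* Along the segment from the identity to [M] the determinant, a polynomial,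
   cannot vanish before the endpoint [M]. *)
Lemma det_psd_ge0 M : loewner_le 0 M -> 0 <= \det M.
Proof.
move=> M0; rewrite leNgt; apply/negP => dM.
pose q : {poly R} := \det ((1 - 'X)%:M + 'X *: map_mx polyC M).
have qE s : q.[s] = \det ((1 - s)%:M + s *: M).
  rewrite -[q.[s]]/(horner_eval s q) -det_map_mx; congr (\det _).
  apply/matrixP => j k; rewrite !mxE.
  transitivity (((1 - 'X) *+ (j == k) + 'X * (M j k)%:P).[s]); first by [].
  by rewrite !(hornerE, hornerMn) mulrnBl.
have [||s /andP[s0 s1] /rootP] := @poly_ivt R (- q) 0 1; first lra.
  by rewrite !hornerN !qE subr0 scale0r addr0 det1 subrr scale1r raddf0 add0r; lra.
rewrite hornerN qE => /eqP; rewrite oppr_eq0 => dets.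
have {s1} : s < 1.
  rewrite lt_neqAle s1 andbT; apply: contraTneq dets => ->.
  by rewrite subrr scale1r raddf0 add0r lt_eqF.
(* A kernel vector [x] at the root [s] gives [(1 - s) |x|^2 + s (x . M x) = 0], where the first term
   is positive and the second nonnegative. *)
move: dets; rewrite -det_tr => /det0P[x x0 xM] s1.
have : dot x (mxapply ((1 - s)%:M + s *: M) x) = 0 by rewrite dotE mxapplyE xM trmx0 mulmx0 mxE.
rewrite mxapplyD mxapply_scalar mxapplyZ dotDr !dotZr.
have := M0 x; rewrite subr0.
have : 0 < dot x x by rewrite lt_def dotxx_ge0 andbT; apply: contra_neq x0; exact: dotxx_eq0.
set a := dot x x; set b := dot x _ => a0 b0.
have : 0 < (1 - s) * a by apply: mulr_gt0 => //; lra.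
have : 0 <= s * b by apply: mulr_ge0.
lra.
Qed.

(** The default value 0 is singular in positive dimension, so a nonzero determinant certifies that a
    root was found. *)
Lemma sqrtmxP B : (0 < d)%N -> \det (sqrtmx B) != 0 ->
  [/\ (sqrtmx B)^T = sqrtmx B, loewner_le 0 (sqrtmx B) & sqrtmx B *m sqrtmx B = B].
Proof.
move=> d0; rewrite /sqrtmx; case: xgetP => [M -> //|_].
by rewrite -[0](scale0r 1%:M) detZ expr0n gtn_eqF// mul0r eqxx.
Qed.

Lemma det_sqrtmx_ge0 B : (0 < d)%N -> 0 <= \det (sqrtmx B).
Proof.
move=> d0; have [->//|/sqrtmxP[]// _ + _] := eqVneq (\det (sqrtmx B)) 0.
exact: det_psd_ge0.
Qed.

Lemma dot_mxapply_sym M x y : M^T = M -> dot (mxapply M x) y = dot x (mxapply M y).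
Proof. by move=> Ms; rewrite !dotE !mxapplyE Ms trmx_mul Ms mulmxA. Qed.

Lemma mxapplyM M N x : mxapply (M *m N) x = mxapply M (mxapply N x).
Proof. by rewrite !mxapplyE trmx_mul mulmxA. Qed.

Lemma enorm_ge0 x : 0 <= enorm x.
Proof. exact: sqrtr_ge0. Qed.

Lemma enorm_sqr x : enorm x ^+ 2 = dot x x.
Proof. by rewrite sqr_sqrtr// dotxx_ge0. Qed.

Lemma enormZ t x : enorm (t *: x) = `|t| * enorm x.
Proof.
apply/eqP; rewrite -(@eqrXn2 _ 2)// ?enorm_ge0 ?mulr_ge0 ?enorm_ge0//.
by rewrite exprMn !enorm_sqr dotZr dotC dotZr real_normK ?num_real// mulrA expr2.
Qed.

(** For a symmetric root [M] of [B], [|M z|^2 = z . M M z = z . B z]. *)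
Lemma enorm_sqrtmx_le B (q : R) z : (0 < d)%N -> \det (sqrtmx B) != 0 -> 0 <= q ->
  dot z (mxapply B z) <= q * dot z z ->
  enorm (mxapply (sqrtmx B) z) <= Num.sqrt q * enorm z.
Proof.
move=> d0 /sqrtmxP[]// Ms _ ME q0 Bz.
rewrite -(@ler_pXn2r _ 2)// ?nnegrE ?enorm_ge0 ?mulr_ge0 ?enorm_ge0 ?sqrtr_ge0//.
by rewrite exprMn !enorm_sqr sqr_sqrtr// dot_mxapply_sym// -mxapplyM ME.
Qed.

End linear_algebra.

Section barycentric.
Context {R : realType} {d : nat}.
Variable T : mesh R d.
Implicit Types (K : {set 'I_(nnode T)}) (x : 'rV[R]_d).

(** The square matrix [N] with rows [(x_k, 1)] is invertible by affine independence, and the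
    coordinates of [x] are [(x, 1)] times its inverse, hence affine in [x]. *)
Lemma barycentric_ex K : #|K| = d.+1 -> affinely_independent K ->
  exists gc : 'I_(nnode T) -> 'rV[R]_d * R, forall x,
    \sum_(k in K) (dot (gc k).1 x + (gc k).2) = 1 /\
    x = \sum_(k in K) (dot (gc k).1 x + (gc k).2) *: node T k.
Proof.
move=> cK aK.
have [k0 k0K] : exists k, k \in K by apply/card_gt0P; rewrite cK.
pose N : 'M[R]_(#|K|, d + 1) := \matrix_(r < #|K|) row_mx (node T (enum_val r)) 1.
have sumE (a : 'rV[R]_#|K|) : a *m N =
  row_mx (\sum_(k in K) a 0 (enum_rank_in k0K k) *: node T k)
    (\sum_(k in K) a 0 (enum_rank_in k0K k))%:M.
  have -> : \sum_(k in K) a 0 (enum_rank_in k0K k) *: node T k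
      = \sum_(r < #|K|) a 0 r *: node T (enum_val r).
    by rewrite big_enum_val/=; apply: eq_bigr => r _; rewrite enum_valK_in.
  have -> : \sum_(k in K) a 0 (enum_rank_in k0K k) = \sum_(r < #|K|) a 0 r.
    by rewrite big_enum_val/=; apply: eq_bigr => r _; rewrite enum_valK_in.
  apply/rowP => l; rewrite mxE; case: (split_ordP l) => {}l ->.
    by rewrite row_mxEl summxE; apply: eq_bigr => r _; rewrite [RHS]mxE [N _ _]mxE row_mxEl.
  rewrite row_mxEr !ord1 mxE eqxx; apply: eq_bigr => r _.
  by rewrite [N _ _]mxE row_mxEr mxE eqxx mulr1.
have fN : row_free N.
  apply: inj_row_free => a; rewrite sumE -row_mx0 => /eq_row_mx[a0 a1].
  have := aK (fun k => a 0 (enum_rank_in k0K k)) _ a0.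
  move=> /(_ _)/wrap[]; first by have /matrixP/(_ 0 0) := a1; rewrite !mxE.
  move=> aK0; apply/rowP => r; rewrite mxE -(enum_valK_in k0K r); apply: aK0.
  exact: enum_valP.
have /row_fullP[B BN] : row_full N by rewrite /row_full (eqP fN) cK addn1.
pose a x : 'rV[R]_#|K| := row_mx x 1 *m B.
(* In the column of [B] for the vertex [k], the first [d] entries are the gradient of the coordinate
   and the last is its constant term. *)
exists (fun k => ((col (enum_rank_in k0K k) (usubmx B))^T, dsubmx B 0 (enum_rank_in k0K k))) => x /=.
have aE k : dot (col (enum_rank_in k0K k) (usubmx B))^T x + dsubmx B 0 (enum_rank_in k0K k) =
    a x 0 (enum_rank_in k0K k).
  rewrite /a -[B in RHS]vsubmxK mul_row_col mul1mx [RHS]mxE; congr (_ + _).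
  by rewrite [RHS]mxE; apply: eq_bigr => j _; rewrite mulrC !mxE.
have : a x *m N = row_mx x 1 by rewrite /a -mulmxA BN mulmx1.
rewrite sumE => /eq_row_mx[e1 /matrixP/(_ 0 0)]; rewrite !mxE eqxx => e2.
split; first by rewrite -[RHS]e2; apply: eq_bigr => k _; exact: aE.
by rewrite -[LHS]e1; apply: eq_bigr => k _; rewrite aE.
Qed.

Lemma barycentric_unique K (a b : 'I_(nnode T) -> R) : affinely_independent K ->
  \sum_(k in K) a k = \sum_(k in K) b k ->
  \sum_(k in K) a k *: node T k = \sum_(k in K) b k *: node T k ->
  {in K, a =1 b}.
Proof.
move=> aK ab abn k kK; apply/eqP; rewrite -subr_eq0; apply/eqP.
apply: (aK (fun k => a k - b k)) => //; first by rewrite sumrB ab subrr.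
by under eq_bigr do rewrite scalerBl; rewrite sumrB abn subrr.
Qed.

End barycentric.

(** * Finite elements *)

Section affine.
Context {R : realType} {d : nat}.
Implicit Types (x g : 'rV[R]_d) (u : 'rV[R]_d -> R).

Lemma affine_continuous g (c : R) : continuous (fun x => dot g x + c).
Proof.
move=> x; apply: (@continuousD _ _ _ (dot g) (fun=> c)); first exact: dot_continuous.
exact: cst_continuous.
Qed.

Lemma dot0r g : dot g 0 = 0.
Proof. by rewrite -(scale0r 0) dotZr mul0r. Qed.

Lemma dotNr g x : dot g (- x) = - dot g x.
Proof. by rewrite -scaleN1r dotZr mulN1r. Qed.

Lemma dot_suml (I : finType) (P : pred I) (a : I -> R) (h : I -> 'rV[R]_d) x :
  dot (\sum_(i | P i) a i *: h i) x = \sum_(i | P i) a i * dot (h i) x.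
Proof.
rewrite dotC; elim/big_rec2 : _ => [|i s t _ <-]; first exact: dot0r.
by rewrite dotDr dotZr dotC.
Qed.

Lemma grad_near_affine u g (c : R) x :
  (\forall y \near x, u y = dot g y + c) -> grad u x = g.
Proof.
move=> ug; apply/rowP => j; rewrite mxE /partial (near_eq_derive _ ug).
rewrite -(dot_delta g j) /derive; apply: cvg_lim => //; apply: cvg_near_cst.
near=> h; rewrite /= dotDr dotZr.
have h0 : h != 0 by near: h; exact: nbhs_dnbhs_neq.
rewrite (_ : _ - _ = h * dot g (delta_mx 0 j)); last by ring.
by rewrite /GRing.scale/= mulKf.
Unshelve. all: by end_near. Qed.

End affine.

(** * Barycentric coordinates on the cells, hat functions and nodal expansions *)

Section mesh.
Context {R : realType} {d : nat} (Omega : set 'rV[R]_d) (T : mesh R d).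
Context (d0 : (0 < d)%N) (confT : conforming_mesh Omega T).
Implicit Types (K L : {set 'I_(nnode T)}) (x y : 'rV[R]_d) (j k : 'I_(nnode T)).
Implicit Types u : 'rV[R]_d -> R.

Definition bary_coeff K : 'I_(nnode T) -> 'rV[R]_d * R :=
  xget (fun=> (0, 0)) [set gc | forall x,
    \sum_(k in K) (dot (gc k).1 x + (gc k).2) = 1 /\
    x = \sum_(k in K) (dot (gc k).1 x + (gc k).2) *: node T k].

Definition bary K k x : R := dot (bary_coeff K k).1 x + (bary_coeff K k).2.

Lemma bary_sum K x : K \in cells T -> \sum_(k in K) bary K k x = 1.
Proof.
case: confT => _ _ cellK _ _ /cellK[cK aK].
by have /(_ x)[] := xgetPex (fun=> (0, 0)) (barycentric_ex cK aK).
Qed.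

Lemma bary_node K x : K \in cells T -> x = \sum_(k in K) bary K k x *: node T k.
Proof.
case: confT => _ _ cellK _ _ /cellK[cK aK].
by have /(_ x)[] := xgetPex (fun=> (0, 0)) (barycentric_ex cK aK).
Qed.

Lemma bary_comb K (a : 'I_(nnode T) -> R) : K \in cells T -> \sum_(k in K) a k = 1 ->
  {in K, forall k, bary K k (\sum_(j in K) a j *: node T j) = a k}.
Proof.
move=> KT a1; have [_ _ /(_ _ KT)[_ aK] _ _] := confT.
apply: (barycentric_unique aK); first by rewrite bary_sum.
by rewrite -bary_node.
Qed.

Lemma bary_at_node K j k : K \in cells T -> j \in K -> k \in K ->
  bary K k (node T j) = (j == k)%:R.
Proof.
move=> KT jK kK; have := bary_comb (a := fun k => (j == k)%:R) KT _ kK.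
have sE (V : zmodType) (F : 'I_(nnode T) -> V) :
    (forall i, i != j -> F i = 0) -> \sum_(i in K) F i = F j.
  by move=> F0; rewrite (bigD1 j)//= big1 ?addr0// => i /andP[_ /F0].
rewrite sE ?eqxx => [/(_ erefl)|i ij]; last by rewrite eq_sym (negPf ij).
by rewrite sE ?eqxx ?scale1r// => i ij; rewrite eq_sym (negPf ij) scale0r.
Qed.

Lemma simplexP K x : K \in cells T ->
  simplex K x <-> {in K, forall k, 0 <= bary K k x}.
Proof.
move=> KT; split => [[c [c0 c1 ->]] k kK|xK]; first by rewrite bary_comb.
(* [simplex] asks for nonnegative coefficients at all indices, while [bary K k] is controlled only
   for [k] in [K]. *)
exists (fun k => if k \in K then bary K k x else 0); split.
- by move=> k; case: ifPn => // /xK.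
- by rewrite -[RHS](bary_sum x KT); apply: eq_bigr => k ->.
- by rewrite [LHS](bary_node x KT); apply: eq_bigr => k ->.
Qed.

Lemma simplex_node K k : K \in cells T -> k \in K -> simplex K (node T k).
Proof. by move=> KT kK; apply/simplexP => // j jK; rewrite bary_at_node. Qed.

Lemma bary_continuous K k : continuous (bary K k).
Proof. exact: affine_continuous. Qed.

Lemma simplex_closed K : K \in cells T -> closed (simplex K).
Proof.
move=> KT; rewrite (_ : simplex K = \bigcap_(k in [set` K]) [set x | 0 <= bary K k x]).
  apply: closed_bigI => k _; apply: (@closed_comp _ _ (bary K k) [set t | 0 <= t]).
    by move=> x _; exact: bary_continuous.
  exact: closed_ge.
by apply/seteqP; split => x; [move=> /simplexP xK k /xK; exact|move=> xK; apply/simplexP].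
Qed.

(** As [d > 0], the cell has another vertex, where the coordinate is 0 instead of 1, so it is not
    constant. *)
Lemma bary_coeff_neq0 K k : K \in cells T -> k \in K -> (bary_coeff K k).1 != 0.
Proof.
move=> KT kK; have [_ _ /(_ _ KT)[cK _] _ _] := confT.
have [j /setD1P[jk jK]] : exists j, j \in K :\ k.
  by apply/card_gt0P; move: cK; rewrite (cardsD1 k) kK add1n => -[->].
apply/eqP => g0; have := bary_at_node KT kK kK; have := bary_at_node KT jK kK.
rewrite /bary g0 ![dot 0 _]dotC !dot0r eqxx (negPf jk) => -> /eqP.
by rewrite eq_sym oner_eq0.
Qed.

Lemma simplex_interior K x : K \in cells T -> {in K, forall k, 0 < bary K k x} ->
  interior (simplex K) x.
Proof.
move=> KT xK; have : \forall y \near x, forall k, k \in K -> 0 < bary K k y.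
  apply: (@filter_forall _ _ (fun k => [set y | k \in K -> 0 < bary K k y]) (nbhs x)) => k.
  have [kK|kK] := boolP (k \in K); last by apply: nearW.
  have xk : \forall y \near x, 0 < bary K k y.
    have /cvgr_gt := @bary_continuous K k x; apply; exact: xK.
  by apply: filterS xk => y yk _.
by apply: filterS => y yK; apply/simplexP => // k kK; exact/ltW/yK.
Qed.

(** The open set of full measure near each point of which every finite element function is
    affine. *)
Definition mesh_interior : set 'rV[R]_d :=
  [set x | exists2 K, K \in cells T & interior (simplex K) x].

Lemma mesh_interior_open : open mesh_interior.
Proof.
rewrite (_ : mesh_interior = \bigcup_(K in [set` cells T]) interior (simplex K)).
  by apply: bigcup_open => K _; exact: open_interior.
by apply/seteqP; split => x [K]; exists K.
Qed.

Lemma mesh_interior_sub : mesh_interior `<=` Omega.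
Proof. by case: confT => _ _ _ _ [_ KO] x [K /KO]; exact. Qed.

Lemma cell_ex x : closure Omega x -> exists2 K, K \in cells T & simplex K x.
Proof. by case: confT => _ _ _ _ [-> _] [K KT Kx]; exists K. Qed.

Lemma closure_simplex K x : K \in cells T -> simplex K x -> closure Omega x.
Proof. by case: confT => _ _ _ _ [-> _] KT Kx; exists K. Qed.

(** A remaining point lies in a cell and has a vanishing barycentric coordinate there, so it is on
    one of finitely many hyperplanes. In particular the boundary of [Omega] is null. *)
Lemma mesh_interior_null :
  lebesgueM (closure Omega `\` mesh_interior : set (lebesgueRd R d)) = 0%E.
Proof.
pose F (p : {set 'I_(nnode T)} * 'I_(nnode T)) : set 'rV[R]_d :=
  if (p.1 \in cells T) && (p.2 \in p.1)
  then [set x | dot (bary_coeff p.1 p.2).1 x = - (bary_coeff p.1 p.2).2] else set0.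
apply: (@lebesgue_null_sub _ _ _ (\bigcup_p F p)); last first.
  apply: lebesgue_null_bigcup => -[K k]; rewrite /F/=; case: ifPn => [/andP[KT kK]|_].
    by apply: hyperplane_null; exact: bary_coeff_neq0.
  exact: lebesgue_outer0.
move=> x [/cell_ex[K KT Kx] xN].
have [k /andP[kK xk]] : exists k, (k \in K) && (bary K k x <= 0).
  apply/existsP; apply: contrapT => /negP/existsPn xK; apply: xN; exists K => //.
  by apply: simplex_interior => // k kK; have := xK k; rewrite kK/= -ltNge.
exists (K, k) => //; rewrite /F/= KT kK/=; apply/eqP; rewrite -addr_eq0; apply/eqP.
by apply/eqP; rewrite eq_le xk/=; move/simplexP : Kx; exact.
Qed.

(** On the cell [K], this is the hat function of the node [k]. *)
Definition bary0 K k x : R := if k \in K then bary K k x else 0.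

Lemma bary0_comb K L x (c : 'I_(nnode T) -> R) : K \in cells T -> L \subset K ->
  \sum_(k in L) c k = 1 -> x = \sum_(k in L) c k *: node T k ->
  forall k, bary0 K k x = if k \in L then c k else 0.
Proof.
move=> KT /fintype.subsetP LK c1 xE k; rewrite /bary0; case: ifPn => kK; last first.
  by case: ifPn => // /LK; rewrite (negPf kK).
have sE (V : zmodType) (F : 'I_(nnode T) -> V) :
    \sum_(i in L) F i = \sum_(i in K) (if i \in L then F i else 0).
  by rewrite -big_mkcondr/=; apply: eq_bigl => i; case: (boolP (i \in L)) => [/LK->|];
    rewrite ?andbF.
rewrite -(@bary_comb K (fun i => if i \in L then c i else 0))//; last by rewrite -sE.
congr bary; rewrite xE sE; apply: eq_bigr => i _.
by case: ifP => //; rewrite scale0r.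
Qed.

(** By conformity [x] is a convex combination of common vertices, and by uniqueness both cells read
    off these coefficients. *)
Lemma bary0_agree K K' k x : K \in cells T -> K' \in cells T ->
  simplex K x -> simplex K' x -> bary0 K k x = bary0 K' k x.
Proof.
move=> KT KT' Kx Kx'; case: confT => _ _ _ /(_ _ _ KT KT') KK _.
have : (simplex K `&` simplex K') x by [].
rewrite KK => -[c [_ c1 xE]].
rewrite (bary0_comb KT _ c1 xE) ?finset.subsetIl//.
by rewrite (bary0_comb KT' _ c1 xE) ?finset.subsetIr.
Qed.

(* The choice of the cell is irrelevant by conformity, and off the mesh
   [xget] returns the empty cell, which gives the value 0. *)
Definition glued k x : R :=
  bary0 (xget finset.set0 [set K | K \in cells T /\ simplex K x]) k x.

Lemma gluedE K k x : K \in cells T -> simplex K x -> glued k x = bary0 K k x.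
Proof.
move=> KT Kx; rewrite /glued.
case: xgetP => [K' _ [KT' Kx']|/(_ K)]; last by case.
exact: bary0_agree.
Qed.

Lemma glued_node j k : glued k (node T j) = (j == k)%:R.
Proof.
case: confT => _ /(_ j)[K KT jK] _ _ _.
rewrite (gluedE _ KT (simplex_node KT jK)) /bary0; case: ifPn => kK.
  exact: bary_at_node.
by case: eqVneq kK => // <-; rewrite jK.
Qed.

Lemma bary0_affine K k : exists (g : 'rV[R]_d) (c : R), forall x, bary0 K k x = dot g x + c.
Proof.
rewrite /bary0; case: (k \in K); first by exists (bary_coeff K k).1, (bary_coeff K k).2.
by exists 0, 0 => x; rewrite dotC dot0r addr0.
Qed.

(** For continuity at [x], the finitely many cells are treated separately: those missing [x] are
    closed and stay away from it, and on the others the function is affine with the same value at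
    [x]. *)
Lemma glued_fe k : fe_space Omega T (glued k).
Proof.
split=> [|K KT]; last first.
  have [g [c gE]] := bary0_affine K k.
  by exists g, c => x Kx; rewrite (gluedE _ KT Kx).
apply/subspace_continuousP => x Ox W /= Wx.
have : \forall y \near x, forall K, K \in cells T -> simplex K y -> W (glued k y).
  apply: (@filter_forall _ _ (fun K =>
    [set y | K \in cells T -> simplex K y -> W (glued k y)]) (nbhs x)) => K.
  have [KT|KT] := boolP (K \in cells T); last by apply: nearW.
  have [Kx|Kx] := pselect (simplex K x); last first.
    have : nbhs x (~` simplex K).
      by apply: open_nbhs_nbhs; split => //; apply: closed_openC; exact: simplex_closed.
    by apply: filterS => y Ky _ /Ky.
  have [g [c gE]] := bary0_affine K k.
  have : nbhs x ((fun y => dot g y + c) @^-1` W).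
    by apply: affine_continuous; rewrite -gE -(gluedE k KT Kx).
  by apply: filterS => y gy _ Ky; rewrite (gluedE k KT Ky) gE.
by apply: filterS => y yW /cell_ex[K KT Ky]; exact: yW Ky.
Qed.

Lemma hatP k : fe_space Omega T (hat Omega k) /\
  forall j, hat Omega k (node T j) = (j == k)%:R.
Proof.
rewrite /hat.
have : exists f, fe_space Omega T f /\ forall j, f (node T j) = (j == k)%:R.
  by exists (glued k); split => [|j]; [exact: glued_fe|exact: glued_node].
by move=> /getPex.
Qed.

Lemma fe_expand u K x : fe_space Omega T u -> K \in cells T -> simplex K x ->
  u x = \sum_(k in K) bary K k x * u (node T k).
Proof.
move=> [_ /(_ K)] + KT Kx => /(_ KT)[g [c uE]].
rewrite uE// [x in dot g x](bary_node x KT) dotC dot_suml.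
rewrite -[c]mul1r -(bary_sum x KT) mulr_suml -big_split/=; apply: eq_bigr => k kK.
by rewrite uE; [rewrite mulrDr [dot g _]dotC|exact: simplex_node].
Qed.

Lemma hatE K k x : K \in cells T -> simplex K x -> hat Omega k x = bary0 K k x.
Proof.
move=> KT Kx; have [hf hn] := hatP k; rewrite (fe_expand hf KT Kx).
under eq_bigr do rewrite hn.
rewrite /bary0; case: ifPn => kK; last first.
  by rewrite big1// => j jK; case: eqVneq jK kK => [-> ->//|]; rewrite mulr0.
rewrite (bigD1 k)//= eqxx mulr1 big1 ?addr0// => j /andP[_ /negPf ->].
by rewrite mulr0.
Qed.

Lemma hat_ge0 k x : closure Omega x -> 0 <= hat Omega k x.
Proof.
move=> /cell_ex[K KT Kx]; rewrite (hatE k KT Kx) /bary0; case: ifPn => // kK.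
by move/simplexP : Kx; exact.
Qed.

Lemma nodal_expansion u x : fe_space Omega T u -> closure Omega x ->
  u x = \sum_k u (node T k) * hat Omega k x.
Proof.
move=> uf /cell_ex[K KT Kx]; rewrite (fe_expand uf KT Kx) big_mkcond/=.
apply: eq_bigr => k _; rewrite (hatE k KT Kx) /bary0; case: ifP => _; last by rewrite mulr0.
by rewrite mulrC.
Qed.

(** The vector is chosen per cell, before the point, so that the gradient is locally constant with
    finitely many values on [mesh_interior]; its measurability and boundedness follow. *)
Lemma fe_grad u : fe_space Omega T u ->
  exists G : {set 'I_(nnode T)} -> 'rV[R]_d, forall K x, K \in cells T ->
    interior (simplex K) x ->
    grad u x = G K /\ \forall y \near x, u y = u x + dot (G K) (y - x).
Proof.
move=> [_ uK].
have /choice[G GE] (K : {set 'I_(nnode T)}) : exists g : 'rV[R]_d, K \in cells T ->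
    exists c, forall x, simplex K x -> u x = dot g x + c.
  have [KT|KT] := boolP (K \in cells T); last by exists 0.
  by have [g gE] := uK _ KT; exists g.
exists G => K x KT Kx; have [c uE] := GE K KT.
have near_uE : \forall y \near x, u y = dot (G K) y + c by apply: filterS Kx => y /uE.
split; first exact: grad_near_affine near_uE.
have ux := nbhs_singleton near_uE.
by apply: filterS near_uE => y ->; rewrite ux dotDr dotNr; ring.
Qed.

(** Inside a cell the nodal expansion holds in a neighbourhood, where the affine forms of the hat
    functions add up to one for [u]. *)
Lemma grad_nodal_expansion u x : fe_space Omega T u -> mesh_interior x ->
  grad u x = \sum_k u (node T k) *: grad (hat Omega k) x.
Proof.
move=> uf [K KT Kx].
have hf k := (hatP k).1.
have /choice[G GE] := fun k => fe_grad (hf k).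
have -> : \sum_k u (node T k) *: grad (hat Omega k) x = \sum_k u (node T k) *: G k K.
  by apply: eq_bigr => k _; rewrite (GE k K x KT Kx).1.
set g := \sum_k _.
apply: (@grad_near_affine _ _ _ _ (u x - dot g x)).
have near_hat : \forall y \near x, forall k, hat Omega k y = hat Omega k x + dot (G k K) (y - x).
  apply: (@filter_forall _ _ (fun k =>
    [set y | hat Omega k y = hat Omega k x + dot (G k K) (y - x)]) (nbhs x)).
  by move=> k; exact: (GE k K x KT Kx).2.
have Kx' := interior_subset Kx.
have KO y : simplex K y -> closure Omega y by exact: closure_simplex.
apply: filterS2 Kx near_hat => y /KO Oy hE.
rewrite (nodal_expansion uf Oy) (nodal_expansion uf (KO _ Kx')).
have -> : dot g y + (\sum_k u (node T k) * hat Omega k x - dot g x) =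
    \sum_k u (node T k) * hat Omega k x + dot g (y - x).
  by rewrite dotDr dotNr; ring.
rewrite dot_suml -big_split/=.
by apply: eq_bigr => k _; rewrite hE mulrDr.
Qed.

End mesh.

(** * The discrete Laplacian *)

Section laplacian.
Context {R : realType} {d : nat} (Omega : set 'rV[R]_d) (T : mesh R d).
Context (d0 : (0 < d)%N) (confT : conforming_mesh Omega T).
Context (openO : open Omega) (bndO : bounded_set Omega).
Implicit Types u v w : 'rV[R]_d -> R.

Lemma fe_node_le v w : fe_space Omega T v -> fe_space Omega T w ->
  (forall x, Omega x -> v x <= w x) -> forall k, v (node T k) <= w (node T k).
Proof.
move=> [cv _] [cw _] vw k; apply: (within_le_closure cv cw vw).
case: confT => _ /(_ k)[K KT kK] _ _ _.
exact: (closure_simplex confT KT (simplex_node confT KT kK)).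
Qed.

Lemma mesh_interior_null_Omega :
  lebesgueM (Omega `\` mesh_interior T : set (lebesgueRd R d)) = 0%E.
Proof.
apply: lebesgue_null_sub (mesh_interior_null d0 confT).
by move=> x [Ox ?]; split => //; exact: subset_closure.
Qed.

Lemma integrable_dot_grad u v : fe_space Omega T u -> fe_space Omega T v ->
  (@lebesgueM R d).-integrable Omega (EFin \o (fun x => dot (grad u x) (grad v x))).
Proof.
move=> /fe_grad[Gu uE] /fe_grad[Gv vE].
apply: (ae_bounded_integrable (D := mesh_interior T) (M := \sum_K `|dot (Gu K) (Gv K)|) bndO).
- by apply: open_measurable_Rd; exact: mesh_interior_open.
- exact: (mesh_interior_sub confT).
- exact: mesh_interior_null_Omega.
- apply: continuous_open_measurable_fun; first exact: mesh_interior_open.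
  move=> x; rewrite inE => -[K KT Kx].
  have : \forall y \near x, dot (grad u y) (grad v y) = dot (grad u x) (grad v x).
    rewrite (uE K x KT Kx).1 (vE K x KT Kx).1.
    have := open_nbhs_nbhs (conj (@open_interior _ (simplex K)) Kx).
    by apply: filterS => y Ky; rewrite (uE K y KT Ky).1 (vE K y KT Ky).1.
  by move=> /cvg_near_cst.
- move=> x [K KT Kx]; rewrite (uE K x KT Kx).1 (vE K x KT Kx).1.
  by rewrite (bigD1 K)//= lerDl sumr_ge0.
Qed.

Lemma integral_dot_grad u i : fe_space Omega T u ->
  \int[lebesgueM]_(x in Omega) dot (grad u x) (grad (hat Omega i) x) =
  \sum_k u (node T k) * stiffness Omega k i.
Proof.
move=> uf; have hf k := (hatP confT k).1.
have mO : @measurable _ (lebesgueRd R d) Omega by exact: open_measurable_Rd.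
have mG : @measurable _ (lebesgueRd R d) (mesh_interior T).
  by apply: open_measurable_Rd; exact: mesh_interior_open.
pose f k (x : lebesgueRd R d) := u (node T k) * dot (grad (hat Omega k) x) (grad (hat Omega i) x).
have If k : (@lebesgueM R d).-integrable Omega (EFin \o f k).
  exact: (integrableZl mO (u (node T k)) (integrable_dot_grad (hf k) (hf i))).
have [Isum sumE] := integrable_Rintegral_sum (index_enum _) mO If.
transitivity (\int[lebesgueM]_(x in Omega) \sum_k f k x); last first.
  rewrite sumE; apply: eq_bigr => k _; rewrite RintegralZl//.
  exact: integrable_dot_grad.
have GO := mesh_interior_sub confT.
(* The gradient expansion is available only inside cells, so both integrals are first restricted to
   [mesh_interior]. *)
rewrite (Rintegral_null mG GO mesh_interior_null_Omega); last exact: integrable_dot_grad.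
rewrite (Rintegral_null mG GO mesh_interior_null_Omega Isum).
apply: eq_Rintegral => x; rewrite inE => Gx.
by rewrite (grad_nodal_expansion confT uf Gx) dot_suml.
Qed.

Lemma discrete_laplacian_mono v w i : fe_space Omega T v -> fe_space Omega T w ->
  (forall x, Omega x -> v x <= w x) -> v (node T i) = w (node T i) ->
  weakly_acute Omega T -> discrete_laplacian Omega v i <= discrete_laplacian Omega w i.
Proof.
move=> vf wf vw vwi acuteT.
rewrite /discrete_laplacian !integral_dot_grad// !mulNr lerN2.
apply: ler_wpM2l.
  rewrite invr_ge0; apply: Rintegral_ge0 => x Ox.
  by apply: (hat_ge0 confT); exact: subset_closure.
apply: ler_sum => k _; have [->|ki] := eqVneq k i; first by rewrite vwi.
by apply: ler_wnM2r; [exact: acuteT|exact: fe_node_le].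
Qed.

End laplacian.

(** * The integral operator *)

Section euclidean_norm.
Context {R : realType} {d : nat}.
Implicit Types (x y z : 'rV[R]_d) (B : 'M[R]_d).

Lemma dotDl x y z : dot (x + y) z = dot x z + dot y z.
Proof. by rewrite dotC dotDr ![dot z _]dotC. Qed.

Lemma mxapplyDv B x y : mxapply B (x + y) = mxapply B x + mxapply B y.
Proof. by rewrite !mxapplyE mulmxDl. Qed.

Lemma mxapplyNv B x : mxapply B (- x) = - mxapply B x.
Proof. by rewrite !mxapplyE mulNmx. Qed.

Lemma mxapplyN B x : mxapply (- B) x = - mxapply B x.
Proof. by rewrite !mxapplyE raddfN mulmxN. Qed.

Lemma coord_le_enorm y j : `|y 0 j| <= enorm y.
Proof.
rewrite -(@ler_pXn2r _ 2)// ?nnegrE ?enorm_ge0// enorm_sqr real_normK ?num_real//.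
rewrite /dot (bigD1 j)//= expr2 lerDl sumr_ge0// => k _.
by rewrite -expr2 sqr_ge0.
Qed.

Lemma norm_le_enorm y : `|y| <= enorm y.
Proof.
rewrite [leLHS]/Num.Def.normr/= mx_normrE; apply/bigmax_leP.
by split => [|[i j] _ /=]; [exact: enorm_ge0|rewrite ord1 coord_le_enorm].
Qed.

Lemma mxapply_continuous B : continuous (mxapply B : 'rV[R]_d -> 'rV[R]_d).
Proof.
move=> x W /nbhs_ballP[e /= e0 eW].
have : \forall y \near x, forall j, `|mxapply B x 0 j - mxapply B y 0 j| < e.
  apply: (@filter_forall _ _ (fun j =>
    [set y | `|mxapply B x 0 j - mxapply B y 0 j| < e]) (nbhs x)) => j.
  have BE y : mxapply B y 0 j = dot (row j B) y.
    by rewrite mxE mxE; apply: eq_bigr => k _; rewrite !mxE.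
  have : \forall y \near x, `|dot (row j B) x - dot (row j B) y| < e.
    by have /cvgr_dist_lt := @dot_continuous R d (row j B) x; exact.
  by apply: filterS => y /=; rewrite !BE.
by apply: filterS => y By; apply: eW; exact/ball_coord.
Qed.

Lemma enorm_continuous : continuous (enorm : 'rV[R]_d -> R).
Proof.
move=> x; apply: (@continuous_comp _ _ _ (fun x => dot x x) Num.sqrt); last exact: sqrt_continuous.
apply: continuous_big => [|j _ {}x]; first exact: add_continuous.
by apply: (@continuousM _ _ (fun y : 'rV[R]_d => y 0 j) (fun y => y 0 j)); exact: coord_continuous.
Qed.

Lemma enorm_ball_open (r : R) : open [set y : 'rV[R]_d | enorm y < r].
Proof.
apply: (@open_comp _ _ enorm [set t | t < r]); last exact: open_lt.
by move=> x _; exact: enorm_continuous.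
Qed.

Lemma enorm_ball_bounded (r : R) : bounded_set [set y : 'rV[R]_d | enorm y <= r].
Proof.
exists r; split => [|M rM y /= yr]; first exact: num_real.
by rewrite (le_trans (norm_le_enorm y))// (le_trans yr)// ltW.
Qed.

Lemma quad_sum B z :
  dot z (mxapply B z) = \sum_p z 0 p.1 * z 0 p.2 * B p.1 p.2.
Proof.
rewrite -(pair_bigA _ (fun k l => z 0 k * z 0 l * B k l))/=; apply: eq_bigr => k _.
by rewrite !mxE mulr_sumr; apply: eq_bigr => l _; rewrite !mxE; ring.
Qed.

Lemma quad_continuous z : continuous (fun B : 'M[R]_d => dot z (mxapply B z)).
Proof.
under eq_fun do rewrite quad_sum.
apply: continuous_big => [|p _ B]; first exact: add_continuous.
apply: (@continuousM _ _ (fun=> z 0 p.1 * z 0 p.2) (fun B : 'M[R]_d => B p.1 p.2)).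
  exact: cst_continuous.
exact: coord_continuous.
Qed.

Lemma bounded_closure (X : set 'rV[R]_d) : bounded_set X -> bounded_set (closure X).
Proof.
move=> [M [Mr XM]]; exists M; split => // M' /XM {}XM x Xx.
have /closure_id/esym cl : closed [set y : 'rV[R]_d | `|y| <= M'].
  apply: (@closed_comp _ _ (fun y : 'rV[R]_d => `|y|) [set t | t <= M']); last exact: closed_le.
  by move=> y _; exact: norm_continuous.
have : closure [set y : 'rV[R]_d | `|y| <= M'] x by apply: closure_subset Xx.
by rewrite cl.
Qed.

Lemma loewner_le_scalarP B (t : R) : loewner_le B t%:M <->
  forall z, dot z (mxapply B z) <= t * dot z z.
Proof.
have E z : dot z (mxapply (t%:M - B) z) = t * dot z z - dot z (mxapply B z).
  by rewrite mxapplyD mxapply_scalar mxapplyN dotDr dotNr dotZr.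
by split=> H z; have := H z; rewrite E subr_ge0.
Qed.

Lemma loewner_ge_scalarP B (t : R) : loewner_le t%:M B <->
  forall z, t * dot z z <= dot z (mxapply B z).
Proof.
have E z : dot z (mxapply (B - t%:M) z) = dot z (mxapply B z) - t * dot z z.
  by rewrite mxapplyD mxapplyN mxapply_scalar dotDr dotNr dotZr.
by split=> H z; have := H z; rewrite E subr_ge0.
Qed.

Lemma quadD B x y : dot (x + y) (mxapply B (x + y)) =
  dot x (mxapply B x) + dot x (mxapply B y) + dot y (mxapply B x) + dot y (mxapply B y).
Proof. by rewrite mxapplyDv dotDl !dotDr; ring. Qed.

Lemma dotNl x y : dot (- x) y = - dot x y.
Proof. by rewrite dotC dotNr dotC. Qed.

Lemma quadB B x y : dot (x - y) (mxapply B (x - y)) =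
  dot x (mxapply B x) - dot x (mxapply B y) - dot y (mxapply B x) + dot y (mxapply B y).
Proof. by rewrite quadD mxapplyNv !dotNl !dotNr; ring. Qed.

Lemma quad_delta B k l : dot (delta_mx 0 k) (mxapply B (delta_mx 0 l)) = B k l.
Proof.
rewrite dotC dot_delta mxE mxE (bigD1 l)//= !mxE !eqxx mulr1 big1 ?addr0// => j /negPf jl.
by rewrite !mxE jl andbF mulr0.
Qed.

(* Polarization with the unit vectors [e_k] and [e_l]. *)
Lemma loewner_entry_bound B (t : R) k l : B^T = B -> 0 <= t ->
  loewner_le 0 B -> loewner_le B t%:M -> `|B k l| <= t.
Proof.
move=> Bs t0 B0 /loewner_le_scalarP Bt.
pose ek : 'rV[R]_d := delta_mx 0 k; pose el : 'rV[R]_d := delta_mx 0 l.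
have Blk : B l k = B k l by rewrite -[in LHS]Bs mxE.
have quad1 z : dot z z = dot z (mxapply 1%:M z) by rewrite mxapply_scalar scale1r.
have := B0 (ek + el); have := B0 (ek - el); rewrite !subr0.
have := Bt (ek + el); have := Bt (ek - el).
rewrite !quad1 !quadB !quadD !quad_delta Blk !mxE !eqxx/= [k == l]eq_sym.
by case: (l == k); rewrite ?mulr1n ?mulr0n ler_norml; lra.
Qed.

End euclidean_norm.

(** * Support and boundedness of the kernel, and nontriviality of the measure *)

Section kernel.
Context {R : realType} {d : nat} (phi : 'rV[R]_d -> R) (kphi : integral_kernel phi).
Implicit Types z : 'rV[R]_d.

Lemma kernel_continuous : continuous phi.
Proof. by case: kphi => /(_ [::])[]. Qed.

(* The support lies in the closed unit ball and [phi != 0] is an open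
   condition, so [phi] also vanishes on the unit sphere. *)
Lemma kernel_support z : phi z != 0 -> enorm z < 1.
Proof.
move=> phiz; rewrite ltNge; apply/negP => z1.
have [_ _ _ supp _] := kphi.
have /nbhs_ballP[e /= e0 eU] : \forall y \near z, phi y != 0.
  by apply: (@kernel_continuous z [set t | t != 0]); apply: open_nbhs_nbhs; split => //;
    exact: open_neq.
(* Small enough that [(1 + t) z] stays within [e] of [z], while its Euclidean norm exceeds 1. *)
pose t := e / 2 / (`|z| + 1).
have z0 : 0 < `|z| + 1 by rewrite ltr_wpDl.
have t0 : 0 < t by rewrite !divr_gt0.
have /eU/subset_closure/supp /= : ball z e ((1 + t) *: z).
  apply/ball_coord => // j; rewrite mxE mulrDl mul1r opprD addNKr normrN normrM gtr0_norm//.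
  apply: (@le_lt_trans _ _ (t * (`|z| + 1))).
    by apply: ler_wpM2l; [exact: ltW|rewrite (le_trans (ler_coord_norm z j))// lerDl].
  by rewrite divfK ?gt_eqF//; lra.
rewrite enormZ gtr0_norm; last by lra.
nra.
Qed.

Lemma kernel_bounded : exists M : R, forall z, `|phi z| <= M.
Proof.
have cB : compact [set y : 'rV[R]_d | enorm y <= 1].
  apply: bounded_closed_compact; first exact: enorm_ball_bounded.
  apply: (@closed_comp _ _ enorm [set t | t <= 1]); last exact: closed_le.
  by move=> x _; exact: enorm_continuous.
have [M [_ /(_ (M + 1))]] : bounded_set (phi @` [set y | enorm y <= 1]).
  apply: compact_bounded; apply: continuous_compact => //.
  by apply: continuous_subspaceT; exact: kernel_continuous.
move=> /(_ ltac:(lra)) phiM; exists (Num.max 0 (M + 1)) => z.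
have [->|/kernel_support/ltW z1] := eqVneq (phi z) 0.
  by rewrite normr0 le_max lexx.
by rewrite le_max phiM ?orbT//; exists z.
Qed.

(** For the zero measure the normalizing integral of the kernel would be 0 instead of [d]. *)
Lemma lebesgue_setT_neq0 : (0 < d)%N -> lebesgueM (setT : set (lebesgueRd R d)) <> 0%E.
Proof.
move=> d0 T0; have [_ _ _ _] := kphi.
rewrite /Rintegral null_set_integral//=; last first.
  apply/measurable_realfun.measurable_EFinP.
  apply: (@null_measurable_fun _ _ set0).
  - exact: measurable0.
  - exact: sub0set.
  - by rewrite setD0.
  - exact: measurable_fun_set0.
by move=> /esym/eqP; rewrite pnatr_eq0 gtn_eqF.
Qed.

End kernel.

(** * Upper bound for the coefficient at a node *)

Section coefficients.
Context {R : realType} {d : nat} (Omega : set 'rV[R]_d) (T : mesh R d).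
Context (d0 : (0 < d)%N) (confT : conforming_mesh Omega T).
Context (openO : open Omega) (bndO : bounded_set Omega).
Context (A : 'rV[R]_d -> 'M[R]_d) (lambda Lambda : R).
Context (lambda_gt0 : 0 < lambda) (le_lambda : lambda <= Lambda).
Context (ellA : elliptic_coefficient Omega A lambda Lambda).
Implicit Types (x z : 'rV[R]_d).

(** A violation at [x] persists in an open neighbourhood, which would then lie in the exceptional
    null set of ellipticity. *)
Lemma continuous_coefficient_bound x z :
  lebesgueM (setT : set (lebesgueRd R d)) <> 0%E ->
  {within Omega, continuous A} -> Omega x ->
  dot z (mxapply (A x) z) <= Lambda * dot z z.
Proof.
move=> T0 cA Ox; rewrite leNgt; apply/negP => xz.
have [_ _ [N [mN N0 AN]]] := ellA.
have {}cA : {for x, continuous A}.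
  by have := cA; rewrite (continuous_open_subspace _ openO) => /(_ x (mem_set Ox)).
have cq : {for x, continuous ((fun B : 'M[R]_d => dot z (mxapply B z)) \o A)}.
  by apply: continuous_comp => //; exact: quad_continuous.
have /nbhs_interior near_x : \forall y \near x, Omega y /\ Lambda * dot z z < dot z (mxapply (A y) z).
  apply: filterI; first exact: open_nbhs_nbhs.
  by apply: (cq [set t | Lambda * dot z z < t]); apply: open_nbhs_nbhs; split => //; exact: open_gt.
set U := interior _ in near_x.
have Ux : U x by exact: nbhs_singleton near_x.
apply: (open_lebesgue_neq0 T0 (@open_interior _ _ : open U)); first by exists x.
apply: lebesgue_null_sub N0 => y /interior_subset[Oy yz];
  apply: AN => /(_ Oy)[_ /loewner_le_scalarP/(_ z)].
by rewrite leNgt yz.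
Qed.

Lemma average_coefficient_bound (i : 'I_(nnode T)) z :
  dot z (mxapply (\matrix_(k, l) ((fine (lebesgueM (hat_supp Omega i)))^-1 *
     \int[lebesgueM]_(x in hat_supp Omega i) A x k l)) z) <= Lambda * dot z z.
Proof.
set E := hat_supp Omega i.
have EO : E `<=` closure Omega.
  have /closure_id -> := @closed_closure _ Omega.
  by apply: closure_subset => x [].
have bndC : bounded_set (closure Omega) by exact: bounded_closure.
have bndE : bounded_set E.
  by case: bndC => M [Mr MO]; exists M; split => // M' /MO OM' x /EO/OM'.
have mE : @measurable _ (lebesgueRd R d) E.
  by apply: closed_measurable_Rd; exact: closed_closure.
have [mA symA [N [mN N0 AN]]] := ellA.
(* [E] may reach the boundary, where nothing is known of [A]; on [D], which lies in [Omega],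
   symmetry and both ellipticity bounds hold. *)
pose D : set (lebesgueRd R d) := (E `&` mesh_interior T) `\` N.
have mG : @measurable _ (lebesgueRd R d) (mesh_interior T).
  by apply: open_measurable_Rd; exact: mesh_interior_open.
have mD : measurable D by apply: measurableD => //; exact: measurableI.
have DE : D `<=` E by move=> x [[]].
have DO : D `<=` Omega by move=> x [[_ /(mesh_interior_sub confT)]].
have ED0 : lebesgueM (E `\` D : set (lebesgueRd R d)) = 0%E.
  apply: (@lebesgue_null_sub _ _ _ ((closure Omega `\` mesh_interior T) `|` N)).
    move=> x [Ex nDx]; have [Nx|Nx] := pselect (N x); [by right|left; split; first exact: EO].
    by move=> Gx; apply: nDx.
  apply/eqP; rewrite eq_le lebesgue_outer_ge0 andbT.
  apply: (le_trans (outer_measureU2 (lebesgue_outer_measure R d) _ _)).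
  by rewrite [X in (X + _)%E](mesh_interior_null d0 confT) add0e [leLHS]N0.
have AD x : D x -> loewner_le lambda%:M (A x) /\ loewner_le (A x) Lambda%:M.
  move=> Dx; have [_ Nx] := Dx; apply: contrapT => nA; apply: Nx; apply: AN => /(_ (DO _ Dx)).
  exact: nA.
have Lambda0 : 0 <= Lambda := le_trans (ltW lambda_gt0) le_lambda.
(* Ellipticity bounds only quadratic forms; symmetry turns this into a bound on the entries. *)
have Aint k l : (@lebesgueM R d).-integrable E (EFin \o (fun x => A x k l)).
  apply: (ae_bounded_integrable (M := Lambda) bndE mD DE ED0).
    by apply: measurable_funS (mA k l); [exact: open_measurable_Rd|exact: DO].
  move=> x Dx; have [/loewner_ge_scalarP Al Au] := AD _ Dx.
  apply: loewner_entry_bound => //; first exact/symA/DO.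
  by move=> y; rewrite subr0 (le_trans _ (Al y))// mulr_ge0 ?dotxx_ge0 ?ltW.
pose f (p : 'I_d * 'I_d) (x : lebesgueRd R d) := z 0 p.1 * z 0 p.2 * A x p.1 p.2.
have If p : (@lebesgueM R d).-integrable E (EFin \o f p).
  exact: (integrableZl mE (z 0 p.1 * z 0 p.2) (Aint p.1 p.2)).
have [Isum sumE] := integrable_Rintegral_sum (index_enum _) mE If.
set m := fine _; have m0 : 0 <= m by apply: fine_ge0; exact: lebesgue_outer_ge0.
have -> : dot z (mxapply (\matrix_(k, l) (m^-1 * \int[lebesgueM]_(x in E) A x k l)) z) =
    m^-1 * \int[lebesgueM]_(x in E) \sum_p f p x.
  rewrite quad_sum sumE mulr_sumr; apply: eq_bigr => p _.
  by rewrite mxE RintegralZl//; ring.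
have Icst c : (@lebesgueM R d).-integrable E (EFin \o fun=> c).
  apply: (@ae_bounded_integrable _ _ E _ _ `|c|) => //; first by rewrite setDv;
    exact: lebesgue_outer0.
have : \int[lebesgueM]_(x in E) \sum_p f p x <= \int[lebesgueM]_(x in E) (Lambda * dot z z).
  rewrite (Rintegral_null mD DE ED0 Isum) (Rintegral_null mD DE ED0 (Icst _)).
  apply: le_Rintegral => //; [exact: integrableS Isum|exact: integrableS (Icst _)|].
  by move=> x /AD[_ /loewner_le_scalarP/(_ z)]; rewrite quad_sum.
rewrite Rintegral_cst// -/m => intE.
have Lz : 0 <= Lambda * dot z z by rewrite mulr_ge0 ?dotxx_ge0.
(* If [m] is 0, the average is 0 by convention, and the bound is nonnegative. *)
have [->|mn0] := eqVneq m 0; first by rewrite invr0 mul0r.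
by rewrite mulrC ler_pdivrMr// lt_def mn0.
Qed.

End coefficients.

(** * Comparison of the integral operators *)

Section integral_operator.
Context {R : realType} {d : nat} (Omega : set 'rV[R]_d) (T : mesh R d).
Context (d0 : (0 < d)%N) (confT : conforming_mesh Omega T).
Context (openO : open Omega) (bndO : bounded_set Omega).
Context (A : 'rV[R]_d -> 'M[R]_d) (lambda Lambda : R).
Context (lambda_gt0 : 0 < lambda) (le_lambda : lambda <= Lambda).
Context (ellA : elliptic_coefficient Omega A lambda Lambda).
Context (eps : R) (eps_gt0 : 0 < eps).
Context (phi : 'rV[R]_d -> R) (kphi : integral_kernel phi).
Implicit Types (x y z : 'rV[R]_d) (v w : 'rV[R]_d -> R).

Local Notation Q := (Qconst lambda Lambda).
Local Notation theta := (theta Omega lambda Lambda eps).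

Lemma Qconst_gt0 : 0 < Q.
Proof. by move: lambda_gt0 le_lambda => l0 lL; rewrite sqrtr_gt0; lra. Qed.

(** The parameters in [[0, 1]] for which the segment from [x] to [x + y] is in [Omega] form an open
    set, also closed because a limit outside [Omega] would be a boundary point too near to [x].
    Connectedness of [[0, 1]] concludes. *)
Lemma ball_sub_domain x y : Omega x -> enorm y < Defs.edist x (topboundary Omega) ->
  Omega (x + y).
Proof.
move=> Ox yx.
have cline : continuous (fun t : R => x + t *: y).
  move=> t; apply: (@continuousD _ _ _ (fun=> x) (fun t : R => t *: y));
    first exact: cst_continuous.
  exact: scalel_continuous.
have scale_lt t : 0 <= t <= 1 -> enorm (t *: y) < Defs.edist x (topboundary Omega).
  move=> /andP[t0 t1]; rewrite enormZ ger0_norm//; apply: le_lt_trans yx.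
  by rewrite ler_piMl ?enorm_ge0.
pose B := `[(0 : R), 1]%classic `&` [set t | Omega (x + t *: y)].
have BE : B = `[(0 : R), 1]%classic.
  apply: segment_connected.
  - by exists 0; split; rewrite /= ?in_itv/= ?lexx ?ler01// scale0r addr0.
  - exists [set t | Omega (x + t *: y)] => //.
    by apply: (@open_comp _ _ (fun t : R => x + t *: y)).
  - exists [set t | closure Omega (x + t *: y)].
      apply: (@closed_comp _ _ (fun t : R => x + t *: y)); first by move=> t _; exact: cline.
      exact: closed_closure.
    apply/seteqP; split => t [t01 Ot]; split => //=; first exact: subset_closure.
    apply: contrapT => nOt; move: t01; rewrite /= in_itv/= => /scale_lt; apply/negP; rewrite -leNgt.
    apply: ge_inf; first by exists 0 => _ [z _ <-]; exact: enorm_ge0.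
    exists (x + t *: y); last by rewrite opprD addNKr -scaleN1r enormZ normrN1 mul1r.
    by split => //; move/interior_subset.
have : `[(0 : R), 1]%classic 1 by rewrite /= in_itv/= ler01 lexx.
by rewrite -BE => -[_ /=]; rewrite scale1r.
Qed.

(* Also true if there is no largest admissible scale: then [theta x = 0]. *)
Lemma theta_inside x y : Omega x -> enorm y < Q * eps ->
  Omega (x + theta x *: y) /\ Omega (x - theta x *: y).
Proof.
move=> Ox yQ; rewrite /theta; case: ifPn => [Qx|_].
  rewrite !scale1r; split; apply: ball_sub_domain => //; first exact: lt_trans Qx.
  by rewrite -scaleN1r enormZ normrN1 mul1r; exact: lt_trans Qx.
case: xgetP => [t _ [[_ tO] _]|_]; first exact: tO.
by rewrite scale0r subr0 addr0.
Qed.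

Lemma Abar_bound (i : 'I_(nnode T)) z : Omega (node T i) ->
  dot z (mxapply (Abar Omega A i) z) <= Lambda * dot z z.
Proof.
move=> Oi; rewrite /Abar; case: asboolP => cA.
  exact: (continuous_coefficient_bound openO ellA z (lebesgue_setT_neq0 kphi d0) cA Oi).
exact: (average_coefficient_bound d0 confT openO bndO lambda_gt0 le_lambda ellA).
Qed.

Section integrand.
Context (i : 'I_(nnode T)) (inti : Omega (node T i)).
Local Notation M := (Mroot Omega A lambda i).

Lemma enorm_Mroot_le z : \det M != 0 -> enorm (mxapply M z) <= Q * enorm z.
Proof.
move=> M0; apply: enorm_sqrtmx_le => //.
  by move: lambda_gt0 le_lambda => l0 lL; lra.
rewrite mxapplyD mxapplyN mxapply_scalar dotDr dotNr dotZr mulrBl.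
by rewrite lerD2r Abar_bound.
Qed.

Definition integrand v y : R :=
  second_diff Omega lambda Lambda eps v (node T i) y / (eps ^+ (d + 2) * \det M) *
  phi (eps^-1 *: mxapply (invmx M) y).

(* If [M] is singular, in particular the default value 0 of [sqrtmx], the
   integrand vanishes because the inverse of 0 is 0. *)
Lemma integrand_support v y : integrand v y != 0 -> enorm y < Q * eps.
Proof.
rewrite /integrand; have [->|M0] := eqVneq (\det M) 0.
  by rewrite mulr0 invr0 mulr0 mul0r eqxx.
rewrite mulf_eq0 negb_or => /andP[_ /(kernel_support kphi)].
rewrite enormZ gtr0_norm ?invr_gt0// mulrC ltr_pdivrMr// mul1r => yeps.
have uM : M \in unitmx by rewrite unitmxE unitfE.
have -> : y = mxapply M (mxapply (invmx M) y).
  by rewrite -mxapplyM mulmxV// mxapply_scalar scale1r.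
apply: (le_lt_trans (enorm_Mroot_le _ M0)).
by rewrite ltr_pM2l// Qconst_gt0.
Qed.

Lemma integrand_mono v w y : (forall x, Omega x -> v x <= w x) ->
  v (node T i) = w (node T i) -> integrand v y <= integrand w y.
Proof.
move=> vw vwi; have [yQ|yQ] := boolP (enorm y < Q * eps); last first.
  have E u : integrand u y = 0.
    by apply/eqP; apply: contraNT yQ; exact: integrand_support.
  by rewrite !E.
have phi0 : forall z, 0 <= phi z by case: kphi.
have [Op Om] := theta_inside inti yQ.
apply: ler_wpM2r => //; apply: ler_wpM2r.
  by rewrite invr_ge0 mulr_ge0 ?det_sqrtmx_ge0// exprn_ge0// ltW.
apply: ler_wpM2l; first by rewrite invr_ge0 sqr_ge0.
by rewrite vwi lerD2r lerD ?vw.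
Qed.

Lemma fe_continuous v x : fe_space Omega T v -> Omega x -> {for x, continuous v}.
Proof.
move=> [/subspace_continuousP cv _] Ox; have := cv x (subset_closure Ox).
rewrite within_interior//; apply: interiorS (subset_closure (A := Omega)) _ _.
by rewrite (interior_id _).1.
Qed.

Lemma fe_bounded v : fe_space Omega T v ->
  forall x, closure Omega x -> `|v x| <= \sum_k `|v (node T k)|.
Proof.
move=> vf x /(cell_ex confT)[K KT Kx]; rewrite (fe_expand confT vf KT Kx).
have b0 k : k \in K -> 0 <= bary K k x by move/(simplexP confT x KT) : Kx => /(_ k).
apply: (le_trans (ler_norm_sum _ _ _)).
rewrite [leRHS](bigID (fun k => k \in K))/= -[leLHS]addr0 lerD ?sumr_ge0//.
apply: ler_sum => k kK; rewrite normrM ger0_norm ?b0// ler_piMl//.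
by rewrite -(bary_sum confT x KT) (bigD1 k)//= lerDl sumr_ge0// => j /andP[/b0].
Qed.

(** Off the closure of [Omega] the values of [v] are arbitrary, but the kernel removes every [y]
    outside the ball of radius [Q * eps]; inside it [v] is evaluated only in [Omega], where it is
    continuous and bounded. *)
Lemma integrand_integrable v : fe_space Omega T v ->
  (@lebesgueM R d).-integrable setT (EFin \o integrand v).
Proof.
move=> vf; pose U : set 'rV[R]_d := [set y | enorm y < Q * eps].
have oU : open U by exact: enorm_ball_open.
have mU : @measurable _ (lebesgueRd R d) U by exact: open_measurable_Rd.
have -> : EFin \o integrand v = (EFin \o integrand v) \_ U.
  apply/funext => y; rewrite patchE; case: ifPn => //= yU.
  have [->//|/integrand_support yQ] := eqVneq (integrand v y) 0.
  by rewrite notin_setE in yU.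
apply/(integrable_mkcond _ mU).
have [P phiP] := kernel_bounded kphi.
pose S := \sum_k `|v (node T k)|.
pose x := node T i.
(* [S] bounds each of the three values of [v] in the second difference, and [P] bounds the
   kernel. *)
pose B := `|(theta x ^+ 2)^-1| * (S + S + 2 * S) * `|(eps ^+ (d + 2) * \det M)^-1| * P.
have S0 : 0 <= S by exact: sumr_ge0.
have vS z : Omega z -> `|v z| <= S by move=> Oz; apply: fe_bounded => //; exact: subset_closure.
apply: (@ae_bounded_integrable _ _ U _ _ B) => //.
- have [r [rr rU]] := @enorm_ball_bounded R d (Q * eps).
  by exists r; split => // r' /rU rU' y /ltW/rU'.
- by rewrite setDv; exact: lebesgue_outer0.
- apply: continuous_open_measurable_fun => // y; rewrite inE => Uy.
  have [Op Om] := theta_inside inti Uy.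
  have shift (t : R) : continuous (fun y => x + t *: y).
    move=> y'; apply: (@continuousD _ _ _ (fun=> x) (fun y : 'rV[R]_d => t *: y));
      first exact: cst_continuous.
    exact: scaler_continuous.
  have cv (t : R) : Omega (x + t *: y) -> {for y, continuous (fun y => v (x + t *: y))}.
    move=> Ot; apply: (@continuous_comp _ _ _ (fun y => x + t *: y) v); first exact: shift.
    exact: fe_continuous.
  have cphi : continuous (fun y => phi (eps^-1 *: mxapply (invmx M) y)).
    move=> y'; apply: (@continuous_comp _ _ _ (fun y => eps^-1 *: mxapply (invmx M) y) phi);
      last exact: kernel_continuous.
    by apply: (@continuous_comp _ _ _ (mxapply (invmx M)) (fun y : 'rV[R]_d => eps^-1 *: y));
      [exact: mxapply_continuous|exact: scaler_continuous].
  apply: (@continuousM _ _ (fun y =>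
    second_diff Omega lambda Lambda eps v x y / (eps ^+ (d + 2) * \det M))); last exact: cphi.
  apply: (@continuousM _ _ (second_diff Omega lambda Lambda eps v x) (fun=> _^-1));
    last exact: cst_continuous.
  apply: (@continuousM _ _ (fun=> _^-1)); first exact: cst_continuous.
  apply: (@continuousB _ _ _ _ (fun=> 2 * v x)); last exact: cst_continuous.
  apply: (@continuousD _ _ _ (fun y => v (x + theta x *: y)) (fun y => v (x - theta x *: y)));
    first exact: cv.
  have -> : (fun y => v (x - theta x *: y)) = (fun y => v (x + (- theta x) *: y)).
    by apply/funext => z; rewrite scaleNr.
  by apply: cv; rewrite scaleNr.
- move=> y /(theta_inside inti)[Op Om].
  rewrite /integrand /second_diff !normrM; apply: ler_pM => //.
  apply: ler_pM => //; apply: ler_pM => //.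
  rewrite (le_trans (ler_normB _ _))// lerD ?normrM ?(@ger0_norm _ 2)//.
    by rewrite (le_trans (ler_normD _ _))// lerD// vS.
  by rewrite ler_pM2l// vS.
Qed.

Lemma integral_op_mono v w : fe_space Omega T v -> fe_space Omega T w ->
  (forall x, Omega x -> v x <= w x) -> v (node T i) = w (node T i) ->
  integral_op Omega A lambda Lambda eps phi v i <= integral_op Omega A lambda Lambda eps phi w i.
Proof.
move=> vf wf vw vwi.
apply: le_Rintegral => //; [exact: integrand_integrable|exact: integrand_integrable|].
by move=> y _; exact: integrand_mono.
Qed.

End integrand.

End integral_operator.

Theorem lemma3p1 (R : realType) (d : nat) (hd : (2 <= d)%N)
  (Omega : set 'rV[R]_d)
  (Omega0 : Omega !=set0) (openO : open Omega) (connO : connected Omega)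
  (bndO : bounded_set Omega)
  (T : mesh R d) (confT : conforming_mesh Omega T)
  (A : 'rV[R]_d -> 'M[R]_d) (lambda Lambda : R)
  (lambda_gt0 : 0 < lambda) (le_lambda : lambda <= Lambda)
  (ellA : elliptic_coefficient Omega A lambda Lambda)
  (eps : R) (eps_gt0 : 0 < eps)
  (phi : 'rV[R]_d -> R) (kphi : integral_kernel phi)
  (v w : 'rV[R]_d -> R) (Vv : fe_space Omega T v) (Vw : fe_space Omega T w)
  (le_vw : forall x, Omega x -> v x <= w x)
  (i : 'I_(nnode T)) (inti : Omega (node T i))
  (eq_vw : v (node T i) = w (node T i)) :
  integral_op Omega A lambda Lambda eps phi v i
    <= integral_op Omega A lambda Lambda eps phi w i /\
  (weakly_acute Omega T ->
    discrete_laplacian Omega v i <= discrete_laplacian Omega w i /\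
    discrete_op Omega A lambda Lambda eps phi v i
      <= discrete_op Omega A lambda Lambda eps phi w i).
Proof.
have d0 : (0 < d)%N by exact: leq_trans hd.
have le_int : integral_op Omega A lambda Lambda eps phi v i
    <= integral_op Omega A lambda Lambda eps phi w i.
  exact: (integral_op_mono d0 confT openO bndO lambda_gt0 le_lambda ellA eps_gt0 kphi inti).
split; first exact: le_int.
move=> acuteT.
have le_lap : discrete_laplacian Omega v i <= discrete_laplacian Omega w i.
  exact: (discrete_laplacian_mono d0 confT openO bndO).
split; first exact: le_lap.
apply: lerD; last exact: le_int.
apply: ler_wpM2l; last exact: le_lap.
by rewrite divr_ge0 ?ler0n// ltW.
Qed.
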